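(* Let $\alpha>0$ and let $\mu$ be a positive Borel measure on $(0,\infty)$ such that $\mu((0,1))=0$ and $\sup_{n\in\mathbb{N}}\int_{1}^{\infty}t^{-(n+1)}\,d\mu(t)<\infty$. Then the Hausdorff operator $\mathcal{H}_{\mu}$ is compact on $F^{2}_{\alpha}$ if and only if $$\lim_{n\to\infty}\int_{1}^{\infty}\frac{1}{t^{n+1}}\,d\mu(t)=0.$$
   Context: $\mathbb{N}=\{0,1,2,\dots\}$. The Fock space $F^2_\alpha$ is the Hilbert space of entire functions $f$ with $\|f\|^2=\frac{\alpha}{\pi}\int_{\mathbb{C}}|f(z)|^2e^{-\alpha|z|^2}\,dA(z)<\infty$, where $dA$ is Lebesgue area measure. For a positive Borel measure $\mu$ on $(0,\infty)$, the Hausdorff operator is $\mathcal{H}_{\mu}(f)(z)=\int_{0}^{\infty}\frac{1}{t}f\left(\frac{z}{t}\right)d\mu(t)$, $z\in\mathbb{C}$. *)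

(* Defs.v *)
From HB Require Import structures.
From mathcomp Require Import all_boot all_order all_algebra.
From mathcomp Require Import all_classical all_reals all_analysis.
From mathcomp Require Import complex.
Set Implicit Arguments. Unset Strict Implicit. Unset Printing Implicit Defensive.
Import Order.TTheory GRing.Theory Num.Theory ComplexField.
Local Open Scope ring_scope.
Local Open Scope classical_set_scope.
Local Open Scope complex_scope.

Definition entire (R : realType) (f : R[i] -> R[i]) : Prop :=
  forall z0 : R[i], exists l : R[i], forall e : R, 0 < e ->
    exists d : R, 0 < d /\
      forall z : R[i], 0 < `|z - z0| < d%:C ->
        `|(f z - f z0) / (z - z0) - l| < e%:C.

Definition fock_norm2 (R : realType) (alpha : R) (f : R[i] -> R[i]) : \bar R :=
  ((alpha / pi)%:E *
   \int[(@lebesgue_measure R \x @lebesgue_measure R)]_(p in setT)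
     (((complex.Re (`|f (p.1 +i* p.2)|) : R) ^+ 2 *
       expR (- alpha * (p.1 ^+ 2 + p.2 ^+ 2)) : R)%:E))%E.

Definition in_fock (R : realType) (alpha : R) (f : R[i] -> R[i]) : Prop :=
  entire f /\ (fock_norm2 alpha f < +oo)%E.

Definition hausdorff (R : realType) (mu : {measure set R -> \bar R})
  (f : R[i] -> R[i]) : R[i] -> R[i] :=
  fun z =>
    (Rintegral mu `]0, +oo[ (fun t => complex.Re (t^-1%:C * f (z / t%:C)))) +i*
    (Rintegral mu `]0, +oo[ (fun t => complex.Im (t^-1%:C * f (z / t%:C)))).

Definition compact_on_fock (R : realType) (alpha : R)
  (T : (R[i] -> R[i]) -> (R[i] -> R[i])) : Prop :=
  (forall f, in_fock alpha f -> in_fock alpha (T f)) /\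
  forall u : nat -> R[i] -> R[i],
    (forall k, in_fock alpha (u k)) ->
    (exists M : R, forall k, (fock_norm2 alpha (u k) <= M%:E)%E) ->
    exists phi : nat -> nat, (forall k, (phi k < phi k.+1)%N) /\
      exists g, in_fock alpha g /\
        (fun k => fock_norm2 alpha (fun z => T (u (phi k)) z - g z)) @ \oo --> 0%E.

Definition moment (R : realType) (mu : {measure set R -> \bar R}) (n : nat) : \bar R :=
  \int[mu]_(t in `[1, +oo[) ((t ^- n.+1)%:E).

(* Main.v *)
(** On Taylor coefficients, [H_mu] acts as the diagonal operator with entries the moments [m_n] of
    [mu], and the Fock norm is the weighted l^2 norm [sum_n |a_n|^2 W_n] with [W_n = ||z^n||^2]. If
    the moments tend to [0], a bounded sequence has a subsequence whose coefficients converge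
    (along an ultrafilter), and small [m_n] control the tails of the images. Conversely, the images
    [m_k z^k / sqrt W_k] of the normalised monomials have a convergent subsequence; since the limit
    has square-summable weighted coefficients, [m_k] tends to [0] along it, hence everywhere
    because the moments decrease.

    The expansion [f(z) = sum_n a_n z^n] of a function that is merely complex differentiable
    everywhere is Cauchy's formula on squares centred at [0], deduced from Goursat's theorem for
    rectangles. The weighted l^2 formula comes from rotation invariance of the planar Gaussian
    measure: averaging [|f|^2] over rotations by roots of unity kills the cross terms. *)

Require Import Defs.
From HB Require Import structures.
From mathcomp Require Import all_boot all_order all_algebra.
From mathcomp Require Import cyclic separable cyclotomic.
From mathcomp Require Import all_classical all_reals all_analysis.
From mathcomp Require Import measurable_realfun.
From mathcomp Require Import complex ring lra.
Set Implicit Arguments. Unset Strict Implicit. Unset Printing Implicit Defensive.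
Import Order.TTheory GRing.Theory Num.Theory ComplexField.
Import numFieldNormedType.Exports.
Local Open Scope ring_scope.
Local Open Scope classical_set_scope.
Local Open Scope complex_scope.

(** Squares instead of circles keep every contour integral a Lebesgue integral over an interval. The
    value 2 pi i is never computed: the integral of 1/w over a square is only shown to be nonzero,
    and Taylor coefficients are divided by it. Likewise the weights W_n are never evaluated:
    finiteness and, for each r, a lower bound c r^(2n) suffice; the latter makes every weighted
    square-summable sequence the Taylor sequence of an entire function. Averaging over finitely many
    rotations needs neither polar coordinates nor an integral over angles. Compactness needs all
    coefficients to converge along one subsequence; a single ultrafilter finer than the filter at
    infinity gives all the limits at once, in place of a diagonal extraction. *)

Section Modulus.
Variable R : realType.
Implicit Types (z w : R[i]) (x : R).

(** In [R[i]] the norm [`|z|] is itself a complex number. *)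
Definition modc z : R := complex.Re `|z|.

Lemma modcE z : `|z| = (modc z)%:C.
Proof. by rewrite /modc normc_def. Qed.

Lemma modc_ge0 z : 0 <= modc z.
Proof. by rewrite -ler0c -modcE. Qed.

Lemma modcM z w : modc (z * w) = modc z * modc w.
Proof. by apply: complexI; rewrite rmorphM/= -!modcE normrM. Qed.

Lemma modcD z w : modc (z + w) <= modc z + modc w.
Proof. by rewrite -lecR rmorphD/= -!modcE ler_normD. Qed.

Lemma modcN z : modc (- z) = modc z.
Proof. by rewrite /modc normrN. Qed.

Lemma modcBC z w : modc (z - w) = modc (w - z).
Proof. by rewrite /modc distrC. Qed.

Lemma modcB z w : modc (z - w) <= modc z + modc w.
Proof. by rewrite -(modcN w) modcD. Qed.

Lemma modc_lerB z w : modc z - modc w <= modc (z - w).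
Proof. by rewrite lerBlDr -{1}(subrK w z) modcD. Qed.

Lemma modcR x : modc x%:C = `|x|.
Proof. by rewrite /modc normc_def/= expr0n/= addr0 sqrtr_sqr. Qed.

Lemma modc0 : modc 0 = 0.
Proof. by rewrite /modc normr0. Qed.

Lemma modc1 : modc 1 = 1.
Proof. by rewrite /modc normr1. Qed.

Lemma modc_eq0 z : (modc z == 0) = (z == 0).
Proof. by rewrite -(normr_eq0 z) modcE -(inj_eq (@complexI R)). Qed.

Lemma modc_gt0 z : (0 < modc z) = (z != 0).
Proof. by rewrite lt_def modc_ge0 andbT modc_eq0. Qed.

Lemma modcX z n : modc (z ^+ n) = modc z ^+ n.
Proof. by elim: n => [|n ih]; rewrite ?expr0 ?modc1// !exprS modcM ih. Qed.

Lemma modcV z : modc z^-1 = (modc z)^-1.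
Proof. by apply: complexI; rewrite -modcE normfV fmorphV/= modcE. Qed.

Lemma modc_sum (I : Type) (r : seq I) (P : pred I) (F : I -> R[i]) :
  modc (\sum_(i <- r | P i) F i) <= \sum_(i <- r | P i) modc (F i).
Proof.
elim/big_ind2 : _ => [|z a w b za wb|//]; first by rewrite modc0.
by rewrite (le_trans (modcD _ _))// lerD.
Qed.

Lemma sqr_modc z : modc z ^+ 2 = complex.Re z ^+ 2 + complex.Im z ^+ 2.
Proof. by apply: complexI; rewrite add_Re2_Im2 modcE rmorphXn. Qed.

Lemma normr_Re z : `|complex.Re z| <= modc z.
Proof.
by rewrite -ler_sqr ?nnegrE ?modc_ge0// real_normK ?num_real// sqr_modc lerDl sqr_ge0.
Qed.

Lemma normr_Im z : `|complex.Im z| <= modc z.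
Proof.
by rewrite -ler_sqr ?nnegrE ?modc_ge0// real_normK ?num_real// sqr_modc lerDr sqr_ge0.
Qed.

Lemma modc_le_ReIm z : modc z <= `|complex.Re z| + `|complex.Im z|.
Proof.
rewrite [in leLHS](complexE z) (le_trans (modcD _ _))// modcM !modcR lerD2l.
by rewrite /modc normc_def/= expr0n/= expr1n add0r sqrtr1 mul1r.
Qed.

Lemma cReB z w : complex.Re (z - w) = complex.Re z - complex.Re w.
Proof. by case: z w => [a b] [c d]. Qed.

Lemma cImB z w : complex.Im (z - w) = complex.Im z - complex.Im w.
Proof. by case: z w => [a b] [c d]. Qed.

Lemma cReD z w : complex.Re (z + w) = complex.Re z + complex.Re w.
Proof. by case: z w => [a b] [c d]. Qed.

Lemma cImD z w : complex.Im (z + w) = complex.Im z + complex.Im w.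
Proof. by case: z w => [a b] [c d]. Qed.

Lemma cReM z w : complex.Re (z * w) =
  complex.Re z * complex.Re w - complex.Im z * complex.Im w.
Proof. by case: z w => [a b] [c d]. Qed.

Lemma cImM z w : complex.Im (z * w) =
  complex.Re z * complex.Im w + complex.Im z * complex.Re w.
Proof. by case: z w => [a b] [c d]. Qed.

End Modulus.
(** * Integrals along segments and Goursat's theorem *)

Section SegmentIntegral.
Variable R : realType.
Implicit Types (a b m : R) (g h : R -> R[i]) (k : R[i]).
Local Notation leb := (@lebesgue_measure R).

(** Unoriented: for b < a the interval is empty and the value is 0. Sides traversed backwards
    therefore carry an explicit minus sign in [rect]. *)
Definition cint a b g : R[i] :=
  (\int[leb]_(x in `[a, b]) complex.Re (g x)) +i*
  (\int[leb]_(x in `[a, b]) complex.Im (g x)).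

(** The nearby point [y] is not confined to the segment. The integrands are restrictions of
    functions differentiable at the points of the segment, so this costs nothing and avoids
    one-sided limits at the endpoints. *)
Definition ccont a b g := forall x, a <= x <= b -> forall e : R, 0 < e ->
  exists2 d : R, 0 < d & forall y, `|y - x| < d -> modc (g y - g x) < e.

Lemma ccontZ a b g k : ccont a b g -> ccont a b (fun x => k * g x).
Proof.
move=> cg x xab e e0.
have k0 : 0 < modc k + 1 by rewrite ltr_wpDl ?modc_ge0.
have [d d0 dg] := cg x xab (e / (modc k + 1)) (divr_gt0 e0 k0).
exists d => // y /dg; rewrite ltr_pdivlMr// -mulrBr modcM mulrC; apply: le_lt_trans.
by rewrite ler_wpM2r ?modc_ge0// lerDl.
Qed.

Lemma ccont_bounded_integrable (P : R[i] -> R) a b g :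
  (forall z w, `|P z - P w| <= modc (z - w)) -> ccont a b g ->
  leb.-integrable `[a, b] (EFin \o (P \o g)).
Proof.
move=> PL cg; apply: continuous_compact_integrable; first exact: segment_compact.
apply: continuous_in_subspaceT => x; rewrite inE/= in_itv/= => xab.
apply/cvgrPdist_lt => e e0.
have [d d0 dg] := cg x xab e e0.
exists d => //= y; rewrite /ball_/= distrC => /dg; rewrite distrC.
by apply: le_lt_trans; exact: PL.
Qed.

Lemma ccont_Re a b g : ccont a b g ->
  leb.-integrable `[a, b] (EFin \o (fun x => complex.Re (g x))).
Proof.
by apply: ccont_bounded_integrable => z w; rewrite -cReB normr_Re.
Qed.

Lemma ccont_Im a b g : ccont a b g ->
  leb.-integrable `[a, b] (EFin \o (fun x => complex.Im (g x))).
Proof.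
by apply: ccont_bounded_integrable => z w; rewrite -cImB normr_Im.
Qed.

Lemma eq_cint a b g h : (forall x, a <= x <= b -> g x = h x) ->
  cint a b g = cint a b h.
Proof.
move=> gh; rewrite /cint; congr (_ +i* _); apply: eq_Rintegral => x;
  by rewrite inE/= in_itv/= => /gh ->.
Qed.

Lemma cintD a b g h : ccont a b g -> ccont a b h ->
  cint a b (fun x => g x + h x) = cint a b g + cint a b h.
Proof.
move=> cg ch; rewrite /cint; apply/eqP; rewrite eq_complex/=.
rewrite -!RintegralD//; [|exact: ccont_Im|exact: ccont_Im|exact: ccont_Re|exact: ccont_Re].
by apply/andP; split; apply/eqP; apply: eq_Rintegral => x _; rewrite ?cReD ?cImD.
Qed.

Lemma cintZ a b g k : ccont a b g ->
  cint a b (fun x => k * g x) = k * cint a b g.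
Proof.
case: k => u v cg; have ig := ccont_Im cg; have rg := ccont_Re cg.
have Z (c : R) (P : R[i] -> R) : leb.-integrable `[a, b] (EFin \o (P \o g)) ->
    leb.-integrable `[a, b] (EFin \o (fun x => c * P (g x))).
  move=> iP; rewrite (_ : _ \o _ = (fun x => c%:E * (EFin \o (P \o g)) x)%E)//.
  exact: integrableZl.
rewrite /cint; apply/eqP; rewrite eq_complex/=.
rewrite -!RintegralZl//.
rewrite -RintegralB//; [|exact: Z|exact: Z].
rewrite -RintegralD//; [|exact: Z|exact: Z].
apply/andP; split; apply/eqP; apply: eq_Rintegral => x _.
  by rewrite cReM.
by rewrite cImM.
Qed.

Lemma cint_split a m b g : a <= m -> m <= b -> ccont a b g ->
  cint a b g = cint a m g + cint m b g.
Proof.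
move=> am mb cg.
have S (P : R[i] -> R) : leb.-integrable `[a, b] (EFin \o (P \o g)) ->
    \int[leb]_(x in `[a, b]) P (g x) =
    \int[leb]_(x in `[a, m]) P (g x) + \int[leb]_(x in `[m, b]) P (g x).
  move=> iP; have := @Rintegral_itvB R (P \o g) (BLeft a) (BRight b) m iP.
  rewrite !bnd_simp => /(_ am mb).
  rewrite (@Rintegral_itv_obnd_cbnd _ m (BRight b) (P \o g)).
    by move=> <-; rewrite addrC subrK.
  by apply: integrableS iP => //; apply: subset_itvr; rewrite bnd_simp.
rewrite /cint; apply/eqP; rewrite eq_complex/=.
by rewrite (S (@complex.Re R)) ?(S (@complex.Im R)) ?eqxx//; [exact: ccont_Im|exact: ccont_Re].
Qed.

(** The factor 2 comes from bounding real and imaginary parts separately. It is harmless, since the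
    estimate only serves to show that quantities are arbitrarily small. *)
Lemma cint_le a b g (M : R) : a <= b -> ccont a b g ->
  (forall x, a <= x <= b -> modc (g x) <= M) ->
  modc (cint a b g) <= 2 * (b - a) * M.
Proof.
move=> ab cg gM.
have S (P : R[i] -> R) : leb.-integrable `[a, b] (EFin \o (P \o g)) ->
    (forall z, `|P z| <= modc z) ->
    `|\int[leb]_(x in `[a, b]) P (g x)| <= (b - a) * M.
  move=> iP PM; rewrite (le_trans (le_normr_Rintegral _ _))//.
  have -> : (b - a) * M = \int[leb]_(x in `[a, b]) M.
    rewrite Rintegral_cst// mulrC; congr (_ * _).
    transitivity (fine (b%:E - a%:E)) => //.
    congr fine; apply/esym.
    apply: etrans; first exact: (lebesgue_measure_itv `[a, b]%R).
    by rewrite /= lte_fin; case: ltgtP ab => //= ->; rewrite subee.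
  apply: le_Rintegral => //.
  - rewrite -[X in integrable _ _ X]/(EFin \o (Num.norm \o (P \o g))).
    exact: (integrable_norm iP).
  - apply/continuous_compact_integrable; first exact: segment_compact.
    by apply: continuous_subspaceT => x; exact: cvg_cst.
  - by move=> x; rewrite /= in_itv/= => /gM; apply: le_trans; exact: PM.
rewrite (le_trans (modc_le_ReIm _))// /cint/= -mulrA mulr_natl mulr2n lerD//.
- by apply: (S (@complex.Re R)); [exact: ccont_Re|exact: normr_Re].
- by apply: (S (@complex.Im R)); [exact: ccont_Im|exact: normr_Im].
Qed.

End SegmentIntegral.

(** * Complex differentiability at a point *)

Section ComplexDerivative.
Variable R : realType.
Implicit Types (F : R[i] -> R[i]) (z w : R[i]).

(** Radii and tolerances are real. [cdiffP] identifies this with derivability in direction 1 over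
    the field [R[i]], from which the product and inverse rules are inherited. *)
Definition cdiff F z := exists l, forall e : R, 0 < e ->
  exists2 d : R, 0 < d & forall w, 0 < modc (w - z) < d ->
    modc ((F w - F z) / (w - z) - l) < e.

Lemma nbhs_modcP (P : R[i]^o -> Prop) :
  (\forall h \near (0 : R[i]^o)^', P h) <->
  (exists2 d : R, 0 < d & forall h, 0 < modc h < d -> P h).
Proof.
split=> [[d /= d0 dP]|[d d0 dP]].
- exists (modc d); first by rewrite modc_gt0 gt_eqF.
  move=> h /andP[h0 hd]; apply: dP; last by rewrite -modc_gt0.
  rewrite /ball_/= sub0r normrN modcE.
  by rewrite -(gtr0_norm d0) modcE ltcR.
- exists d%:C; first by rewrite /= -[0]/(0%:C) ltcR.
  move=> h; rewrite /ball_/= sub0r normrN modcE ltcR => hd h0.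
  by apply: dP; rewrite hd modc_gt0 h0.
Qed.

Lemma cdiffP F z : cdiff F z <-> derivable (F : R[i]^o -> R[i]^o) (z : R[i]^o) 1.
Proof.
split=> [[l H]|/cvg_ex[l /= /cvgrPdist_lt H]].
- apply/cvg_ex; exists l; apply/cvgrPdist_lt => e e0.
  have me0 : 0 < modc e by rewrite modc_gt0 gt_eqF.
  have [d d0 dH] := H _ me0.
  apply/nbhs_modcP; exists d => // h hd.
  rewrite -(gtr0_norm e0) !modcE ltcR modcBC.
  have := dH (h + z); rewrite addrK => /(_ hd).
  by rewrite /GRing.scale/= mulr1 mulrC.
- exists l => e e0; have e0' : 0 < e%:C by rewrite -[0]/(0%:C) ltcR.
  have /nbhs_modcP[d d0 dH] := H e%:C e0'.
  exists d => // w /dH; rewrite modcE ltcR modcBC/= mulrC.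
  by rewrite /GRing.scale/= mulr1 subrK.
Qed.

Lemma entireP (f : R[i] -> R[i]) : entire f <-> forall z, cdiff f z.
Proof.
split=> H z; have [l lH] := H z; exists l => e /lH.
- case=> d [d0 dP]; exists d => // w wd.
  by rewrite -ltcR -modcE; apply: dP; rewrite modcE -[0]/(0%:C) !ltcR.
- case=> d d0 dP; exists d; split=> // w; rewrite -[0]/(0%:C) !modcE !ltcR.
  exact: dP.
Qed.

(** Clearing the denominator admits w = z, so the affine estimate holds on full discs, as Goursat's
    argument requires. *)
Lemma cdiff_approx F z : cdiff F z -> exists l, forall e : R, 0 < e ->
  exists2 d : R, 0 < d & forall w, modc (w - z) < d ->
    modc (F w - F z - l * (w - z)) <= e * modc (w - z).
Proof.
move=> [l lH]; exists l => e /lH[d d0 dH]; exists d => // w wd.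
have [->|wz] := eqVneq w z; first by rewrite !subrr mulr0 subr0 modc0 mulr0.
have wz0 : w - z != 0 by rewrite subr_eq0.
have -> : F w - F z - l * (w - z) = ((F w - F z) / (w - z) - l) * (w - z).
  by rewrite mulrBl divfK.
by rewrite modcM ler_wpM2r ?modc_ge0// ltW// dH// wd modc_gt0 wz0.
Qed.

Lemma cdiff_cont F z : cdiff F z -> forall e : R, 0 < e ->
  exists2 d : R, 0 < d & forall w, modc (w - z) < d -> modc (F w - F z) < e.
Proof.
move=> /cdiff_approx[l H] e e0; have [d d0 dH] := H 1 ltr01.
have L0 : 0 < modc l + 1 by rewrite ltr_wpDl ?modc_ge0.
exists (Num.min d (e / (modc l + 1))); first by rewrite lt_min d0 divr_gt0.
move=> w; rewrite lt_min ltr_pdivlMr// => /andP[/dH wd we].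
rewrite -(subrK (l * (w - z)) (F w - F z)) (le_lt_trans (modcD _ _))// modcM.
rewrite mul1r in wd; apply: le_lt_trans we.
by rewrite [leRHS]mulrDr mulr1 [_ * modc l]mulrC addrC lerD2l.
Qed.

Lemma cdiff_dquot_bounded F z : cdiff F z -> exists2 d : R, 0 < d & exists M : R,
  forall w, 0 < modc (w - z) < d -> modc ((F w - F z) / (w - z)) <= M.
Proof.
move=> [l H]; have [d d0 dH] := H 1 ltr01.
exists d => //; exists (1 + modc l) => w /dH; move: (_ / _) => q ql.
rewrite -(subrK l q) (le_trans (modcD _ _))// lerD2r ltW//.
Qed.

Lemma cdiff_cst (c : R[i]) z : cdiff (fun=> c) z.
Proof. by apply/cdiffP; exact: derivable_cst. Qed.

Lemma cdiff_id z : cdiff id z.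
Proof. by apply/cdiffP; exact: derivable_id. Qed.

Lemma cdiffB F (G : R[i] -> R[i]) z : cdiff F z -> cdiff G z -> cdiff (fun w => F w - G w) z.
Proof. by move=> /cdiffP ? /cdiffP ?; apply/cdiffP; exact: derivableB. Qed.

Lemma cdiffM F (G : R[i] -> R[i]) z : cdiff F z -> cdiff G z -> cdiff (fun w => F w * G w) z.
Proof. move=> /cdiffP dF /cdiffP dG; apply/cdiffP.
exact: (@derivableM R[i] R[i]^o F G z 1 dF dG). Qed.

Lemma cdiffV F z : F z != 0 -> cdiff F z -> cdiff (fun w => (F w)^-1) z.
Proof. by move=> ? /cdiffP ?; apply/cdiffP; exact: derivableV. Qed.

Lemma cdiffX n z : cdiff (fun w => w ^+ n) z.
Proof.
elim: n => [|n ih]; first exact: cdiff_cst.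
under eq_fun do rewrite exprS.
exact: (cdiffM (cdiff_id z) ih).
Qed.

End ComplexDerivative.

(** * Goursat's theorem for rectangles *)

Section Goursat.
Variable R : realType.
Implicit Types (F G : R[i] -> R[i]) (a b c d m : R).

Lemma midpoint a b : a <= b ->
  [/\ a <= (a + b) / 2, (a + b) / 2 <= b, (a + b) / 2 - a = (b - a) / 2 &
      b - (a + b) / 2 = (b - a) / 2].
Proof. by move=> ab; split; lra. Qed.

(** Cousin-type induction: if [P] failed, it would fail on one quarter at each bisection. The nested
    failing rectangles shrink to a common point, where the local hypothesis contradicts the
    failure. *)
Lemma rect_bisect (P : R -> R -> R -> R -> Prop) a0 b0 c0 d0 :
  a0 <= b0 -> c0 <= d0 ->
  (forall a b c d, a <= b -> c <= d ->
    P a ((a + b) / 2) c ((c + d) / 2) -> P ((a + b) / 2) b c ((c + d) / 2) ->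
    P a ((a + b) / 2) ((c + d) / 2) d -> P ((a + b) / 2) b ((c + d) / 2) d ->
    P a b c d) ->
  (forall x y, a0 <= x <= b0 -> c0 <= y <= d0 -> exists2 e : R, 0 < e &
    forall a b c d, a <= x <= b -> c <= y <= d -> (b - a) + (d - c) < e ->
      P a b c d) ->
  P a0 b0 c0 d0.
Proof.
move=> ab0 cd0 bisect loc; apply: contrapT => nP0.
pose good (q : R * R * R * R) :=
  [/\ q.1.1.1 <= q.1.1.2, q.1.2 <= q.2 & ~ P q.1.1.1 q.1.1.2 q.1.2 q.2].
(* Rectangles bundled with their failure of [P], so that dependent choice produces the whole nested
   sequence. *)
pose T := {q | good q}.
pose nest (p q : T) :=
  let: (a, b, c, d) := sval p in let: (a', b', c', d') := sval q in
  [/\ a <= a', b' <= b, c <= c', d' <= d &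
      (b' - a' = (b - a) / 2) /\ (d' - c' = (d - c) / 2)].
have [f [f0 fnest]] : {f : nat -> T | f 0%N = exist _ (a0, b0, c0, d0) (And3 ab0 cd0 nP0) /\
    forall n, nest (f n) (f n.+1)}.
  apply: dependent_choice => -[[[[a b] c] d] [/= ab cd nP]].
  apply: cid; apply: contrapT => /forallNP/= H; move: (nP); apply.
  have [am mb ma bm] := midpoint ab; have [cn nd nc dn] := midpoint cd.
  apply: bisect => //; apply: contrapT => nPq.
  - have gq : good (a, (a + b) / 2, c, (c + d) / 2) by [].
    by apply: (H (exist _ _ gq)); rewrite /nest/=.
  - have gq : good ((a + b) / 2, b, c, (c + d) / 2) by [].
    by apply: (H (exist _ _ gq)); rewrite /nest/=.
  - have gq : good (a, (a + b) / 2, (c + d) / 2, d) by [].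
    by apply: (H (exist _ _ gq)); rewrite /nest/=.
  - have gq : good ((a + b) / 2, b, (c + d) / 2, d) by [].
    by apply: (H (exist _ _ gq)); rewrite /nest/=.
pose fa n := (sval (f n)).1.1.1; pose fb n := (sval (f n)).1.1.2.
pose fc n := (sval (f n)).1.2; pose fd n := (sval (f n)).2.
have G n : [/\ fa n <= fb n, fc n <= fd n & ~ P (fa n) (fb n) (fc n) (fd n)].
  by rewrite /fa /fb /fc /fd; case: (f n).
have N n : [/\ fa n <= fa n.+1, fb n.+1 <= fb n, fc n <= fc n.+1, fd n.+1 <= fd n &
    (fb n.+1 - fa n.+1 = (fb n - fa n) / 2) /\ (fd n.+1 - fc n.+1 = (fd n - fc n) / 2)].
  have := fnest n; rewrite /nest /fa /fb /fc /fd.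
  by case: (f n) => -[[[? ?] ?] ?] ? /=; case: (f n.+1) => -[[[? ?] ?] ?] ?.
have squeeze (u v : nat -> R) : (forall n, u n <= v n) -> (forall n, u n <= u n.+1) ->
    (forall n, v n.+1 <= v n) -> exists x, forall n, u n <= x <= v n.
  move=> uv ui vd.
  have um : {homo u : i j / (i <= j)%N >-> i <= j} by apply: homo_leq => //; exact: le_trans.
  have vm : {homo v : i j / (i <= j)%N >-> i >= j}.
    by apply: homo_leq => // ? ? ? H1 H2; exact: le_trans H2 H1.
  have uvm i j : u i <= v j.
    have [ij|/ltnW ji] := leqP i j.
      by rewrite (le_trans (um _ _ ij)).
    by rewrite (le_trans (uv _))// vm.
  exists (sup (range u)) => n; apply/andP; split.
    by apply: ub_le_sup; [exists (v 0%N) => _ [k _ <-]; exact: uvm|exists n].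
  by apply: ge_sup; [exists (u 0%N), 0%N|move=> _ [k _ <-]; exact: uvm].
have [x xP] := squeeze fa fb (fun n => let: And3 H _ _ := G n in H)
  (fun n => let: And5 H _ _ _ _ := N n in H) (fun n => let: And5 _ H _ _ _ := N n in H).
have [y yP] := squeeze fc fd (fun n => let: And3 _ H _ := G n in H)
  (fun n => let: And5 _ _ H _ _ := N n in H) (fun n => let: And5 _ _ _ H _ := N n in H).
have [E1 E2 E3 E4] : [/\ fa 0%N = a0, fb 0%N = b0, fc 0%N = c0 & fd 0%N = d0].
  by rewrite /fa /fb /fc /fd f0.
have [||e e0 eP] := loc x y; [by rewrite -E1 -E2|by rewrite -E3 -E4|].
have size n : (fb n - fa n) + (fd n - fc n) = ((b0 - a0) + (d0 - c0)) / 2 ^+ n.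
  elim: n => [|n ih]; first by rewrite E1 E2 E3 E4 expr0 divr1.
  have [_ _ _ _ [-> ->]] := N n; rewrite -mulrDl ih exprSr invfM; ring.
set S := (b0 - a0) + (d0 - c0) in size.
have S0 : 0 <= S by rewrite addr_ge0// subr_ge0.
(* The half-perimeter after n bisections is S / 2^n, and 2^n > n > S / e brings it below the local
   radius. *)
pose n := Num.bound (S / e).
have nS : S / e < n%:R by apply: archi_boundP; rewrite divr_ge0// ltW.
have [_ _] := G n; apply; apply: eP => //.
rewrite size ltr_pdivrMr ?exprn_gt0// mulrC -ltr_pdivrMr//.
by rewrite (lt_le_trans nS)// -natrX ler_nat ltnW// ltn_expl.
Qed.

(** The integral of [F] along the counterclockwise boundary of [[a, b] x [c, d]]. *)
Definition rect F a b c d : R[i] :=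
  cint a b (fun x => F (x +i* c)) - cint a b (fun x => F (x +i* d)) +
  (0 +i* 1) * (cint c d (fun y => F (b +i* y)) - cint c d (fun y => F (a +i* y))).

Definition hcont F a b c := ccont a b (fun x => F (x +i* c)).
Definition vcont F a c d := ccont c d (fun y => F (a +i* y)).

Lemma rect_split_x F a m b c d : a <= m -> m <= b ->
  hcont F a b c -> hcont F a b d ->
  rect F a b c d = rect F a m c d + rect F m b c d.
Proof.
move=> am mb hc hd; rewrite /rect (cint_split am mb hc) (cint_split am mb hd).
ring.
Qed.

Lemma rect_split_y F a b c m d : c <= m -> m <= d ->
  vcont F a c d -> vcont F b c d ->
  rect F a b c d = rect F a b c m + rect F a b m d.
Proof.
move=> cm md va vb; rewrite /rect (cint_split cm md va) (cint_split cm md vb).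
ring.
Qed.

Lemma hcont_cdiff F a b c : (forall x, a <= x <= b -> cdiff F (x +i* c)) -> hcont F a b c.
Proof.
move=> dF x /dF/cdiff_cont H e /H[d d0 dP]; exists d => // y yx.
apply: dP; rewrite (_ : _ - _ = (y - x)%:C) ?modcR//.
by apply/eqP; rewrite eq_complex/= subrr !eqxx.
Qed.

Lemma vcont_cdiff F a c d : (forall y, c <= y <= d -> cdiff F (a +i* y)) -> vcont F a c d.
Proof.
move=> dF x /dF/cdiff_cont H e /H[r r0 rP]; exists r => // y yx.
apply: rP; rewrite (_ : _ - _ = (0 +i* 1) * (y - x)%:C).
  by rewrite modcM modcR /modc normc_def/= expr0n expr1n add0r sqrtr1 mul1r.
by apply/eqP; rewrite eq_complex/=; apply/andP; split; apply/eqP; ring.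
Qed.

Lemma modcI : modc (0 +i* 1 : R[i]) = 1.
Proof. by rewrite /modc normc_def/= expr0n expr1n add0r sqrtr1. Qed.

Lemma rect_le F a b c d (M : R) : a <= b -> c <= d ->
  hcont F a b c -> hcont F a b d -> vcont F a c d -> vcont F b c d ->
  (forall x y, a <= x <= b -> c <= y <= d ->
     (x == a) || (x == b) || (y == c) || (y == d) -> modc (F (x +i* y)) <= M) ->
  modc (rect F a b c d) <= 4 * ((b - a) + (d - c)) * M.
Proof.
move=> ab cd hc hd va vb FM.
have h1 := cint_le ab hc; have h2 := cint_le ab hd.
have v1 := cint_le cd va; have v2 := cint_le cd vb.
rewrite /rect (le_trans (modcD _ _))// (_ : 4 * _ * _ =
  (2 * (b - a) * M + 2 * (b - a) * M) + (2 * (d - c) * M + 2 * (d - c) * M)); last by ring.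
rewrite lerD//.
  rewrite (le_trans (modcB _ _))// lerD ?h1 ?h2// => x xab;
    by apply: FM; rewrite ?lexx ?cd ?eqxx ?orbT.
rewrite modcM modcI mul1r (le_trans (modcB _ _))// lerD ?v1 ?v2// => x xab;
  by apply: FM; rewrite ?lexx ?ab ?eqxx ?orbT.
Qed.

Lemma cint_cst (k : R[i]) a b : a <= b -> cint a b (fun=> k) = (b - a)%:C * k.
Proof.
move=> ab; rewrite /cint !Rintegral_cst//.
have -> : fine ((@lebesgue_measure R) `[a, b]) = b - a.
  transitivity (fine (b%:E - a%:E)) => //; congr fine.
  apply: etrans; first exact: (lebesgue_measure_itv `[a, b]%R).
  by rewrite /= lte_fin; case: ltgtP ab => //= ->; rewrite subee.
by case: k => u v /=; apply/eqP; rewrite eq_complex/=; apply/andP; split; apply/eqP; ring.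
Qed.

Lemma ccont_cst a b (k : R[i]) : ccont a b (fun=> k).
Proof. by move=> x _ e e0; exists 1 => // y _; rewrite subrr modc0. Qed.

Lemma rectB F G a b c d :
  hcont F a b c -> hcont F a b d -> vcont F a c d -> vcont F b c d ->
  hcont G a b c -> hcont G a b d -> vcont G a c d -> vcont G b c d ->
  rect (fun w => F w - G w) a b c d = rect F a b c d - rect G a b c d.
Proof.
move=> h1 h2 h3 h4 k1 k2 k3 k4.
have B (a' b' : R) (g h : R -> R[i]) : ccont a' b' g -> ccont a' b' h ->
    cint a' b' (fun x => g x - h x) = cint a' b' g - cint a' b' h.
  move=> cg ch; rewrite -[- cint _ _ _]mulN1r -cintZ// -cintD//; last exact: ccontZ.
  by apply: eq_cint => x _; rewrite mulN1r.
rewrite /rect (B a b _ _ h1 k1) (B a b _ _ h2 k2) (B c d _ _ h3 k3) (B c d _ _ h4 k4).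
ring.
Qed.

Lemma rectZ F (k : R[i]) a b c d :
  hcont F a b c -> hcont F a b d -> vcont F a c d -> vcont F b c d ->
  rect (fun w => k * F w) a b c d = k * rect F a b c d.
Proof.
move=> h1 h2 h3 h4.
rewrite /rect (cintZ k h1) (cintZ k h2) (cintZ k h3) (cintZ k h4); ring.
Qed.

Lemma rect_affine (p q : R[i]) a b c d : a <= b -> c <= d ->
  rect (fun w => p + q * w) a b c d = 0.
Proof.
move=> ab cd.
have dA w : cdiff (fun w => p + q * w) w.
  rewrite (_ : (fun w => _) = (fun w => p - (- q) * w)); last first.
    by apply/funext => u; rewrite mulNr opprK.
  by apply: cdiffB; [exact: cdiff_cst|apply: cdiffM; [exact: cdiff_cst|exact: cdiff_id]].
have H u v t : hcont (fun w => p + q * w) u v t by apply: hcont_cdiff => *; exact: dA.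
have V u v t : vcont (fun w => p + q * w) u v t by apply: vcont_cdiff => *; exact: dA.
have B (a' b' : R) (g h : R -> R[i]) : ccont a' b' g -> ccont a' b' h ->
    cint a' b' g - cint a' b' h = cint a' b' (fun x => g x - h x).
  move=> cg ch; rewrite -[- cint _ _ _]mulN1r -cintZ// -cintD//; last exact: ccontZ.
  by apply: eq_cint => x _; rewrite mulN1r.
rewrite /rect (B _ _ _ _ (H a b c) (H a b d)) (B _ _ _ _ (V b c d) (V a c d)).
rewrite (@eq_cint _ a b _ (fun=> q * (0 +i* (c - d)))); last first.
  move=> x _; case: (p) (q) => [p1 p2] [q1 q2].
  by apply/eqP; rewrite eq_complex/=; apply/andP; split; apply/eqP; ring.
rewrite (@eq_cint _ c d _ (fun=> q * (b - a)%:C)); last first.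
  move=> x _; case: (p) (q) => [p1 p2] [q1 q2].
  by apply/eqP; rewrite eq_complex/=; apply/andP; split; apply/eqP; ring.
rewrite !cint_cst//; case: (q) => [q1 q2].
by apply/eqP; rewrite eq_complex/=; apply/andP; split; apply/eqP; ring.
Qed.

Lemma modc_ReIm (x y x' y' : R) : modc (x +i* y - x' +i* y') <= `|x - x'| + `|y - y'|.
Proof. exact: modc_le_ReIm. Qed.

(** Affine functions integrate to 0 around a rectangle, so only the error of an affine approximation
    counts. *)
Lemma rect_le_affine F (p l : R[i]) a b c d (M : R) : a <= b -> c <= d ->
  (forall x y, a <= x <= b -> c <= y <= d -> cdiff F (x +i* y)) ->
  (forall x y, a <= x <= b -> c <= y <= d ->
    modc (F (x +i* y) - (p + l * (x +i* y))) <= M) ->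
  modc (rect F a b c d) <= 4 * ((b - a) + (d - c)) * M.
Proof.
move=> ab cd dF FM.
have dA w : cdiff (fun w => p + l * w) w.
  rewrite (_ : (fun w => _) = (fun w => p - (- l) * w)); last first.
    by apply/funext => u; rewrite mulNr opprK.
  by apply: cdiffB; [exact: cdiff_cst|apply: cdiffM; [exact: cdiff_cst|exact: cdiff_id]].
have dFA x y : a <= x <= b -> c <= y <= d -> cdiff (fun w => F w - (p + l * w)) (x +i* y).
  by move=> xab ycd; apply: cdiffB; [exact: dF|exact: dA].
have -> : rect F a b c d = rect (fun w => F w - (p + l * w)) a b c d.
  rewrite rectB ?rect_affine ?subr0//; (apply: hcont_cdiff || apply: vcont_cdiff) => *;
    (apply: dA || (apply: dF; rewrite ?lexx ?ab ?cd//)).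
apply: rect_le => //; try by move=> *; exact: FM.
- by apply: hcont_cdiff => *; apply: dFA; rewrite ?lexx ?ab ?cd.
- by apply: hcont_cdiff => *; apply: dFA; rewrite ?lexx ?ab ?cd.
- by apply: vcont_cdiff => *; apply: dFA; rewrite ?lexx ?ab ?cd.
- by apply: vcont_cdiff => *; apply: dFA; rewrite ?lexx ?ab ?cd.
Qed.

Theorem goursat F a b c d : a <= b -> c <= d ->
  (forall x y, a <= x <= b -> c <= y <= d -> cdiff F (x +i* y)) ->
  rect F a b c d = 0.
Proof.
move=> ab cd dF.
suff H (e : R) : 0 < e -> modc (rect F a b c d) <= e.
  apply/eqP; rewrite -modc_eq0 eq_le modc_ge0 andbT; apply/ler_addgt0Pl => e e0.
  by rewrite addr0 H.
(* The aim is a bound by [k] times the squared half-perimeter, which is at most [e] for this [k].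
   The added 1 keeps [S] positive for degenerate rectangles. *)
move=> e0; pose S := (b - a) + (d - c) + 1.
have S0 : 0 < S by rewrite ltr_wpDl// addr_ge0// subr_ge0.
pose k := e / S ^+ 2; have k0 : 0 < k by rewrite divr_gt0// exprn_gt0.
(* The trivial guards turn the goal into an instance of [P] below, where they confine a subrectangle
   to the original rectangle. *)
suff : (a <= a) -> (b <= b) -> (c <= c) -> (d <= d) ->
   modc (rect F a b c d) <= k * ((b - a) + (d - c)) ^+ 2.
  move=> /(_ (lexx _) (lexx _) (lexx _) (lexx _)); move=> /le_trans; apply.
  rewrite /k mulrAC ler_pdivrMr ?exprn_gt0// ler_pM2l//.
  have T0 : 0 <= (b - a) + (d - c) by rewrite addr_ge0 ?subr_ge0.
  by apply: lerXn2r; rewrite ?nnegrE ?(ltW S0)// /S lerDl.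
pose P a' b' c' d' := a <= a' -> b' <= b -> c <= c' -> d' <= d ->
   modc (rect F a' b' c' d') <= k * ((b' - a') + (d' - c')) ^+ 2.
have hF a' b' c' : a <= a' -> b' <= b -> c <= c' -> c' <= d -> hcont F a' b' c'.
  move=> h1 h2 h3 h4; apply: hcont_cdiff => x /andP[h5 h6]; apply: dF; last by rewrite h3.
  by rewrite (le_trans h1 h5) (le_trans h6 h2).
have vF a' c' d' : a <= a' -> a' <= b -> c <= c' -> d' <= d -> vcont F a' c' d'.
  move=> h1 h2 h3 h4; apply: vcont_cdiff => x /andP[h5 h6]; apply: dF; first by rewrite h1.
  by rewrite (le_trans h3 h5) (le_trans h6 h4).
apply: (@rect_bisect P) => //.
- move=> a' b' c' d' ab' cd'; rewrite /P.
  set m := (a' + b') / 2; set n := (c' + d') / 2 => H1 H2 H3 H4 la lb lc ld.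
  have [am mb _ _] := midpoint ab'; have [cn nd _ _] := midpoint cd'.
  rewrite -/m -/n in am mb cn nd.
  (* Halving the sides divides the squared half-perimeter by 4, so the bounds on the four quarters
     add up exactly to the bound on the whole. *)
  have E : k * (b' - a' + (d' - c')) ^+ 2 =
    (k * (m - a' + (n - c')) ^+ 2 + k * (b' - m + (n - c')) ^+ 2) +
    (k * (m - a' + (d' - n)) ^+ 2 + k * (b' - m + (d' - n)) ^+ 2).
    by rewrite /m /n; field.
  clearbody m n; rewrite E.
  have am2 := le_trans la am; have mb2 := le_trans mb lb.
  have cn2 := le_trans lc cn; have nd2 := le_trans nd ld.
  have ba2 := le_trans ab' lb; have ab2 := le_trans la ab'.
  have cd2 := le_trans cd' ld; have dc2 := le_trans lc cd'.
  have {}H1 := H1 la mb2 lc nd2; have {}H2 := H2 am2 lb lc nd2.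
  have {}H3 := H3 la mb2 cn2 ld; have {}H4 := H4 am2 lb cn2 ld.
  rewrite (rect_split_y cn nd); [|exact: vF|exact: vF].
  rewrite (rect_split_x am mb (hF a' b' c' la lb lc cd2) (hF a' b' n la lb cn2 nd2)).
  rewrite (rect_split_x am mb (hF a' b' n la lb cn2 nd2) (hF a' b' d' la lb dc2 ld)).
  by rewrite (le_trans (modcD _ _))// lerD// (le_trans (modcD _ _))// lerD.
- move=> x y xab ycd; have [l lP] := cdiff_approx (dF x y xab ycd).
  (* On a rectangle of half-perimeter [s] containing the point, the affine error is at most k / 4 *
     s, and [rect_le_affine] multiplies it by 4 * s. *)
  have [|r r0 rP] := lP (k / 4); first by rewrite divr_gt0.
  exists r => // a' b' c' d' /andP[ax xb] /andP[cy yd] sr; rewrite /P => la lb lc ld.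
  set s := _ + _ in sr *; pose p := F (x +i* y) - l * (x +i* y).
  have -> : k * s ^+ 2 = 4 * s * (k / 4 * s) by field.
  apply: (@rect_le_affine _ p l) => [| |x' y' /andP[h1 h2] /andP[h3 h4]|
      x' y' /andP[h1 h2] /andP[h3 h4]].
  + exact: le_trans xb.
  + exact: le_trans yd.
  + by apply: dF; apply/andP; split;
      [exact: le_trans h1|exact: le_trans lb|exact: le_trans h3|exact: le_trans ld].
  + have ws : modc (x' +i* y' - x +i* y) <= s.
      rewrite (le_trans (modc_ReIm _ _ _ _))// lerD// ler_distl; apply/andP.
        by clear -ax xb h1 h2; split; lra.
      by clear -cy yd h3 h4; split; lra.
    have -> : F (x' +i* y') - (p + l * (x' +i* y')) =
       F (x' +i* y') - F (x +i* y) - l * (x' +i* y' - x +i* y) by rewrite /p; ring.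
    rewrite (le_trans (rP _ _))//; first exact: le_lt_trans sr.
    by rewrite ler_pM2l// divr_gt0.
Qed.

End Goursat.
(** * Taylor expansion of entire functions *)

Section Taylor.
Variable R : realType.
Implicit Types (F f g : R[i] -> R[i]) (a b c d r : R) (z w : R[i]).

Lemma cplx_neq (x y x0 y0 : R) : (x != x0) || (y != y0) -> x +i* y != x0 +i* y0.
Proof. by rewrite eq_complex/= negb_and. Qed.

(** The frame between the two rectangles is cut into four rectangles that avoid the exceptional
    point; [goursat] makes each contribute 0. *)
Lemma rect_deform F x0 y0 a a' b' b c c' d' d :
  (forall w, w != x0 +i* y0 -> cdiff F w) ->
  a <= a' -> a' < x0 -> x0 < b' -> b' <= b ->
  c <= c' -> c' < y0 -> y0 < d' -> d' <= d ->
  rect F a b c d = rect F a' b' c' d'.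
Proof.
move=> dF aa ax xb bb cc cy yd dd.
have hF u v t : t != y0 -> hcont F u v t.
  by move=> ty; apply: hcont_cdiff => x _; apply: dF; apply: cplx_neq; rewrite ty orbT.
have vF u v t : t != x0 -> vcont F t u v.
  by move=> tx; apply: vcont_cdiff => x _; apply: dF; apply: cplx_neq; rewrite tx.
have cy0 : c != y0 by rewrite lt_eqF// (le_lt_trans cc).
have dy0 : d != y0 by rewrite gt_eqF// (lt_le_trans yd).
have ax0 : a' != x0 by rewrite lt_eqF.
have bx0 : b' != x0 by rewrite gt_eqF.
have ab : a' <= b' by rewrite ltW// (lt_trans ax).
have cd : c' <= d' by rewrite ltW// (lt_trans cy).
have ab2 := le_trans ab bb; have cd2 := le_trans cd dd.
have ac2 := le_trans cc cd2.
rewrite (rect_split_x aa ab2 (hF _ _ _ cy0) (hF _ _ _ dy0)).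
rewrite (rect_split_x ab bb (hF _ _ _ cy0) (hF _ _ _ dy0)).
rewrite (rect_split_y cc cd2 (vF _ _ _ ax0) (vF _ _ _ bx0)).
rewrite (rect_split_y cd dd (vF _ _ _ ax0) (vF _ _ _ bx0)).
rewrite (goursat aa ac2); last first.
  move=> x y /andP[_ xa] _; apply: dF; apply: cplx_neq.
  by rewrite lt_eqF// (le_lt_trans xa).
rewrite (goursat bb ac2); last first.
  move=> x y /andP[xa _] _; apply: dF; apply: cplx_neq.
  by rewrite gt_eqF// (lt_le_trans xb).
rewrite (goursat ab cc); last first.
  move=> x y _ /andP[_ xa]; apply: dF; apply: cplx_neq.
  by rewrite (lt_eqF (le_lt_trans xa cy)) orbT.
rewrite (goursat ab dd); last first.
  move=> x y _ /andP[xa _]; apply: dF; apply: cplx_neq.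
  by rewrite (gt_eqF (lt_le_trans yd xa)) orbT.
by rewrite !(add0r, addr0).
Qed.

Definition sq F r := rect F (- r) r (- r) r.

Lemma sq_boundary r x y : 0 <= r ->
  (x == - r) || (x == r) || (y == - r) || (y == r) -> r <= modc (x +i* y).
Proof.
move=> r0; rewrite -!orbA => /or4P[] /eqP ->.
- by rewrite (le_trans _ (normr_Re _))//= normrN ger0_norm.
- by rewrite (le_trans _ (normr_Re _))//= ger0_norm.
- by rewrite (le_trans _ (normr_Im _))//= normrN ger0_norm.
- by rewrite (le_trans _ (normr_Im _))//= ger0_norm.
Qed.

(** The boundary of the square of half-side [r] lies in this region, which is easier to handle than
    the four sides; the poles to be avoided have modulus below [r]. *)
Definition sq_cdiff F r := forall w, r <= modc w -> cdiff F w.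

Lemma sq_cont F r : 0 <= r -> sq_cdiff F r ->
  [/\ hcont F (- r) r (- r), hcont F (- r) r r, vcont F (- r) (- r) r & vcont F r (- r) r].
Proof.
move=> r0 dF; split; (apply: hcont_cdiff || apply: vcont_cdiff) => x _; apply: dF;
  by apply: sq_boundary => //; rewrite eqxx ?orbT.
Qed.

Lemma sq_le F r M : 0 <= r -> sq_cdiff F r ->
  (forall x y, - r <= x <= r -> - r <= y <= r -> r <= modc (x +i* y) ->
     modc (F (x +i* y)) <= M) -> modc (sq F r) <= 16 * r * M.
Proof.
move=> r0 dF FM; have [h1 h2 v1 v2] := sq_cont r0 dF.
rewrite (_ : 16 * r * M = 4 * ((r - - r) + (r - - r)) * M); last by ring.
apply: rect_le => //; rewrite ?ge0_cp//.
by move=> x y xr yr bd; apply: FM => //; exact: sq_boundary.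
Qed.

Lemma sqB F g r : 0 <= r -> sq_cdiff F r -> sq_cdiff g r ->
  sq (fun w => F w - g w) r = sq F r - sq g r.
Proof.
move=> r0 /(sq_cont r0)[h1 h2 v1 v2] /(sq_cont r0)[k1 k2 u1 u2].
exact: rectB.
Qed.

Lemma sqZ F k r : 0 <= r -> sq_cdiff F r -> sq (fun w => k * F w) r = k * sq F r.
Proof. by move=> r0 /(sq_cont r0)[h1 h2 v1 v2]; exact: rectZ. Qed.

Lemma sq_indep F r r' : (forall w, w != 0 -> cdiff F w) -> 0 < r -> r <= r' ->
  sq F r' = sq F r.
Proof.
move=> dF r0 rr'; apply: (@rect_deform F 0 0) => //; rewrite ?lerN2// ?oppr_lt0//.
Qed.

Lemma ccont_bounded a b (h : R -> R[i]) : a <= b -> ccont a b h ->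
  exists M, forall x, a <= x <= b -> modc (h x) <= M.
Proof.
move=> ab ch.
have [|c _ cmax] := @EVT_max R (fun x => modc (h x)) a b ab.
  apply: continuous_in_subspaceT => x; rewrite inE/= in_itv/= => xab.
  apply/cvgrPdist_lt => e e0; have [d d0 dh] := ch x xab e e0.
  exists d => //= y; rewrite /ball_/= distrC => /dh; apply: le_lt_trans.
  by rewrite ler_norml modcBC modc_lerB andbT lerNl opprB modcBC modc_lerB.
by exists (modc (h c)) => x xab; apply: cmax; rewrite in_itv.
Qed.

Lemma sq_bounded F r : 0 <= r -> sq_cdiff F r -> exists M, 0 <= M /\
  forall x y, - r <= x <= r -> - r <= y <= r ->
     (x == - r) || (x == r) || (y == - r) || (y == r) -> modc (F (x +i* y)) <= M.
Proof.
move=> r0 /(sq_cont r0)[h1 h2 v1 v2]; have rr : - r <= r by rewrite ge0_cp.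
have [M1 H1] := ccont_bounded rr h1; have [M2 H2] := ccont_bounded rr h2.
have [M3 H3] := ccont_bounded rr v1; have [M4 H4] := ccont_bounded rr v2.
exists (`|M1| + `|M2| + `|M3| + `|M4|); split; first by rewrite !addr_ge0.
move=> x y xr yr.
have N1 := ler_norm M1; have N2 := ler_norm M2.
have N3 := ler_norm M3; have N4 := ler_norm M4.
have P1 := normr_ge0 M1; have P2 := normr_ge0 M2.
have P3 := normr_ge0 M3; have P4 := normr_ge0 M4.
rewrite -!orbA => /or4P[] /eqP e; move: xr yr; rewrite e => xr yr.
- by have := H3 _ yr; clear -N1 N2 N3 N4 P1 P2 P3 P4; lra.
- by have := H4 _ yr; clear -N1 N2 N3 N4 P1 P2 P3 P4; lra.
- by have := H1 _ xr; clear -N1 N2 N3 N4 P1 P2 P3 P4; lra.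
- by have := H2 _ xr; clear -N1 N2 N3 N4 P1 P2 P3 P4; lra.
Qed.

(** The difference quotient is bounded near [z], so its integral over squares shrinking to
    [z] tends to [0]. *)
Lemma sq_dquot0 f z r : (forall w, cdiff f w) -> modc z < r ->
  sq (fun w => (f w - f z) / (w - z)) r = 0.
Proof.
move=> df zr; set F := fun w => _.
have dF w : w != z -> cdiff F w.
  move=> wz; apply: cdiffM; first by apply: cdiffB; [exact: df|exact: cdiff_cst].
  by apply: cdiffV; [rewrite subr_eq0|apply: cdiffB; [exact: cdiff_id|exact: cdiff_cst]].
have [d d0 [M FM]] := cdiff_dquot_bounded (df z).
case: z zr @F dF FM => x0 y0 zr F dF FM.
have /ltr_normlP[x1 x2] : `|x0| < r by exact: le_lt_trans (normr_Re _) zr.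
have /ltr_normlP[y1 y2] : `|y0| < r by exact: le_lt_trans (normr_Im _) zr.
(* The distance from the centre to the nearest side: smaller squares around it stay inside the large
   one. *)
pose m := Num.min (Num.min (r - x0) (r + x0)) (Num.min (r - y0) (r + y0)).
have m0 : 0 < m by rewrite !lt_min; apply/andP; split; apply/andP; split; lra.
have FM0 : 0 <= `|M| by [].
suff H eta : 0 < eta -> eta <= m -> eta + eta < d -> modc (sq F r) <= 16 * eta * `|M|.
  apply/eqP; rewrite -modc_eq0 eq_le modc_ge0 andbT; apply/ler_addgt0Pl => e e0.
  (* The three bounds keep the small square inside, keep it within the disc where the quotient is
     bounded, and bring 16 * eta * |M| below [e]. *)
  rewrite addr0; pose eta := Num.min m (Num.min (d / 3) (e / (16 * (`|M| + 1)))).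
  have M1 : 0 < 16 * (`|M| + 1) by rewrite mulr_gt0// ltr_wpDl.
  have eta0 : 0 < eta by rewrite lt_min m0/= lt_min divr_gt0//= divr_gt0.
  have etam : eta <= m by rewrite /eta ge_min lexx.
  have etad : eta <= d / 3 by rewrite /eta !ge_min lexx orbT.
  have etae : eta <= e / (16 * (`|M| + 1)) by rewrite /eta !ge_min lexx !orbT.
  have := H eta eta0 etam ltac:(clear -d0 etad; lra).
  move=> /le_trans; apply; move: etae; rewrite ler_pdivlMr//; apply: le_trans.
  by clear -eta0 FM0; nra.
move=> eta0; rewrite !le_min => /andP[/andP[h1 h2] /andP[h3 h4]] hd.
rewrite /sq (@rect_deform F x0 y0 (- r) (x0 - eta) (x0 + eta) r
  (- r) (y0 - eta) (y0 + eta) r) //;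
  try (by clear -h1 h2 h3 h4 eta0; lra).
have -> : 16 * eta * `|M| =
    4 * ((x0 + eta - (x0 - eta)) + (y0 + eta - (y0 - eta))) * `|M| by ring.
apply: rect_le; try (by clear -eta0; lra).
- apply: hcont_cdiff => x _; apply: dF; apply: cplx_neq.
  by apply/orP; right; apply/eqP; clear -eta0; lra.
- apply: hcont_cdiff => x _; apply: dF; apply: cplx_neq.
  by apply/orP; right; apply/eqP; clear -eta0; lra.
- apply: vcont_cdiff => x _; apply: dF; apply: cplx_neq.
  by apply/orP; left; apply/eqP; clear -eta0; lra.
- apply: vcont_cdiff => x _; apply: dF; apply: cplx_neq.
  by apply/orP; left; apply/eqP; clear -eta0; lra.
move=> x y /andP[xa xb] /andP[ya yb] bd; apply: (le_trans _ (ler_norm M)); apply: FM.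
rewrite modc_gt0 subr_eq0; apply/andP; split.
  apply: cplx_neq; move: bd; rewrite -!orbA => /or4P[] /eqP ->; apply/orP;
    [left|left|right|right]; apply/eqP; clear -eta0; lra.
apply: le_lt_trans hd; rewrite (le_trans (modc_ReIm _ _ _ _))// lerD// ler_distl; apply/andP.
  by clear -xa xb; split; lra.
by clear -ya yb; split; lra.
Qed.

Lemma geometric_small (C q e : R) : 0 <= q < 1 -> 0 < e ->
  exists N0, forall N, (N0 <= N)%N -> C * q ^+ N < e.
Proof.
move=> /andP[q0 q1] e0; have := @cvg_geometric R C q; rewrite ger0_norm// => /(_ q1).
move=> /cvgrPdist_lt/(_ e e0)[N0 _ H]; exists N0 => N /H; rewrite /= sub0r normrN.
by apply: le_lt_trans; rewrite ler_norm.
Qed.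

(** On the boundary |z / w| <= |z| / r < 1, so the remainder of the geometric series of 1 / (w - z)
    integrates to a geometrically small quantity. [A] enters through an equation so that
    coefficients found on another square can be supplied. *)
Lemma cauchy_expansion g z r (A : nat -> R[i]) : (forall w, cdiff g w) -> modc z < r ->
  (forall n, A n = sq (fun w => g w / w ^+ n.+1) r) ->
  forall e, 0 < e -> exists N0, forall N, (N0 <= N)%N ->
    modc (\sum_(n < N) A n * z ^+ n - sq (fun w => g w / (w - z)) r) < e.
Proof.
move=> dg zr AE e e0.
have r0 : 0 < r by exact: le_lt_trans (modc_ge0 z) zr.
have wn0 w : r <= modc w -> w != 0 by move=> h; rewrite -modc_gt0 (lt_le_trans r0).
have wnz w : r <= modc w -> w - z != 0.
  move=> h; rewrite subr_eq0; apply: contraTneq h => ->; by rewrite -ltNge.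
have dG : sq_cdiff (fun w => g w / (w - z)) r.
  move=> w rw; apply: cdiffM; first exact: dg.
  by apply: cdiffV; [exact: wnz|apply: cdiffB; [exact: cdiff_id|exact: cdiff_cst]].
(* the remainder of the geometric series of [1 / (w - z)] after [N] terms *)
pose T N := fun w => (z / w) ^+ N * (g w / (w - z)).
have dV n : sq_cdiff (fun w => (w ^+ n)^-1) r.
  by move=> w rw; apply: cdiffV; [rewrite expf_neq0// wn0|exact: cdiffX].
have dT N : sq_cdiff (T N) r.
  move=> w rw; rewrite /T.
  rewrite (_ : (fun w => _) =
    (fun w => z ^+ N * (w ^+ N)^-1 * (g w / (w - z)))); last first.
    by apply/funext => u; rewrite exprMn exprVn.
  apply: cdiffM; last exact: dG.
  by apply: cdiffM; [exact: cdiff_cst|exact: dV].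
have dA n : sq_cdiff (fun w => g w / w ^+ n.+1) r.
  by move=> w rw; apply: cdiffM; [exact: dg|exact: dV].
have dzA n : sq_cdiff (fun w => z ^+ n * (g w / w ^+ n.+1)) r.
  by move=> w rw; apply: cdiffM; [exact: cdiff_cst|exact: dA].
have eq_sq F G : (forall w, r <= modc w -> F w = G w) -> sq F r = sq G r.
  move=> FG; rewrite /sq /rect.
  by congr (_ - _ + _ * (_ - _)); apply: eq_cint => x xr; apply: FG;
    apply: sq_boundary; rewrite ?eqxx ?orbT// ltW.
have step N : sq (T N) r = A N * z ^+ N + sq (T N.+1) r.
  have -> : sq (T N.+1) r = sq (fun w => T N w - z ^+ N * (g w / w ^+ N.+1)) r.
    apply: eq_sq => w rw; rewrite /T; have := wn0 w rw; have := wnz w rw.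
    rewrite !exprMn !exprVn !exprS => h1 h2.
    by field; rewrite h1 h2 expf_neq0.
  by rewrite sqB ?ltW// sqZ ?ltW// -AE mulrC addrC subrK.
have sum N : sq (T 0%N) r = \sum_(n < N) A n * z ^+ n + sq (T N) r.
  by elim: N => [|N ih]; [rewrite big_ord0 add0r|rewrite big_ord_recr/= -addrA -step].
have T0E : sq (fun w => g w / (w - z)) r = sq (T 0%N) r.
  by apply: eq_sq => w _; rewrite /T expr0 mul1r.
have [B [B0 BP]] := sq_bounded (ltW r0) dG.
have [||N0 N0P] := @geometric_small (16 * r * B) (modc z / r) e => //.
  by rewrite divr_ge0 ?modc_ge0 ?(ltW r0)//= ltr_pdivrMr// mul1r.
exists N0 => N /N0P; apply: le_lt_trans.
rewrite T0E (sum N) opprD addrA subrr sub0r modcN.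
have [h1 h2 v1 v2] := sq_cont (ltW r0) (dT N).
rewrite (_ : 16 * r * B * _ = 4 * ((r - - r) + (r - - r)) * ((modc z / r) ^+ N * B)); last by ring.
apply: rect_le; rewrite ?ge0_cp ?(ltW r0)//.
move=> x y xr yr bd; rewrite /T modcM modcX modcM modcV.
rewrite ler_pM ?exprn_ge0 ?modc_ge0 ?mulr_ge0 ?invr_ge0 ?modc_ge0//; last exact: BP.
rewrite lerXn2r ?nnegrE ?mulr_ge0 ?invr_ge0 ?modc_ge0 ?(ltW r0)// ler_wpM2l ?modc_ge0//.
have rw := sq_boundary (ltW r0) bd.
by rewrite lef_pV2 ?posrE// (lt_le_trans r0).
Qed.

Lemma cint_Im_ge a b (h : R -> R[i]) (m : R) : a <= b -> ccont a b h ->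
  (forall x, a <= x <= b -> m <= complex.Im (h x)) -> (b - a) * m <= complex.Im (cint a b h).
Proof.
move=> ab ch hm.
have := cint_cst (0 +i* m) ab; case=> _ /=; rewrite mul0r addr0 => <-.
have im : (@lebesgue_measure R).-integrable `[a, b] (EFin \o (fun=> m)).
  by apply: (@ccont_Im R a b (fun=> 0 +i* m)); exact: ccont_cst.
have ih := ccont_Im ch.
by apply: le_Rintegral => // x; rewrite /= in_itv/= => /hm.
Qed.

(** With the orientation factor included, the integrand on each side has imaginary part 1 / (x^2 +
    1) >= 1/2. Each side of length 2 thus contributes at least 1 to the imaginary part. *)
Lemma sqV_neq0 : sq (fun w => w^-1) 1 != 0.
Proof.
have dV : sq_cdiff (fun w => w^-1) 1.
  move=> w w1; apply: cdiffV; [by rewrite -modc_gt0 (lt_le_trans _ w1)|exact: cdiff_id].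
have [h1 h2 v1 v2] := sq_cont ler01 dV.
suff H : 0 < complex.Im (sq (fun w => w^-1) 1) by apply: contraTneq H => ->; rewrite ltxx.
have half x : - 1 <= x <= 1 -> 1 / 2 <= (x ^+ 2 + 1)^-1 :> R.
  move=> /andP[xa xb]; rewrite div1r lef_pV2 ?posrE//; last by nra.
  by nra.
have h11 : - 1 <= 1 :> R by lra.
have H1 := cint_Im_ge h11 h1 (m := 1 / 2).
have H2 := cint_Im_ge h11 (ccontZ (-1) h2) (m := 1 / 2).
have H3 := cint_Im_ge h11 (ccontZ (0 +i* 1) v2) (m := 1 / 2).
have H4 := cint_Im_ge h11 (ccontZ (0 +i* (-1)) v1) (m := 1 / 2).
rewrite /sq /rect.
set c1 := cint _ _ _; set c2 := cint _ _ _; set c3 := cint _ _ _; set c4 := cint _ _ _.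
have -> : c1 - c2 + (0 +i* 1) * (c3 - c4) =
   c1 + (-1) * c2 + (0 +i* 1) * c3 + (0 +i* (-1)) * c4.
  case: c1 c2 c3 c4 => [? ?] [? ?] [? ?] [? ?].
  by apply/eqP; rewrite eq_complex/=; apply/andP; split; apply/eqP; ring.
rewrite /c1 /c2 /c3 /c4 -!cintZ// !cImD.
have {}H1 := H1 _; have {}H2 := H2 _; have {}H3 := H3 _; have {}H4 := H4 _.
pose q : R := (1 - -1) * (1 / 2).
apply: (@lt_le_trans _ _ (q + q + q + q)); first by rewrite /q; lra.
apply: lerD; first apply: lerD; first apply: lerD.
- apply: H1 => x /half; congr (_ <= _) => /=.
  by rewrite sqrrN expr1n mulN1r opprK.
- apply: H2 => x /half; congr (_ <= _) => /=.
  by rewrite expr1n; ring.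
- apply: H3 => x /half; congr (_ <= _) => /=.
  by rewrite expr1n [_ + 1]addrC; ring.
- apply: H4 => x /half; congr (_ <= _) => /=.
  by rewrite sqrrN expr1n [_ + 1]addrC; ring.
Qed.

(** The integral does not depend on the size of the square, while the integrand decays faster than
    the perimeter grows. *)
Lemma sqVX_eq0 n : sq (fun w => (w ^+ n.+2)^-1) 1 = 0.
Proof.
set F := fun w : R[i] => _.
have dF w : w != 0 -> cdiff F w.
  by move=> w0; apply: cdiffV; [rewrite expf_neq0|exact: cdiffX].
apply/eqP; rewrite -modc_eq0 eq_le modc_ge0 andbT; apply/ler_addgt0Pl => e e0.
(* The bound is 16 * r / r^(n+2), at most 16 / r because r >= 1, hence at most [e]. *)
rewrite addr0; pose r := Num.max 1 (16 / e).
have r1 : 1 <= r by rewrite le_max lexx.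
have r0 : 0 < r by exact: lt_le_trans r1.
rewrite -(sq_indep dF ltr01 r1).
apply: le_trans (sq_le (M := (r ^+ n.+2)^-1) (ltW r0) _ _) _.
- by move=> w rw; apply: dF; rewrite -modc_gt0 (lt_le_trans r0).
- move=> x y _ _ rw; rewrite /F modcV modcX lef_pV2 ?posrE ?exprn_gt0// ?(lt_le_trans r0)//.
  by rewrite lerXn2r ?nnegrE ?modc_ge0// ltW.
- rewrite ler_pdivrMr ?exprn_gt0// mulrC exprS mulrCA ler_wpM2l ?(ltW r0)//.
  have re : 16 <= e * r by rewrite mulrC -ler_pdivrMr// le_max lexx orbT.
  apply: le_trans re _; rewrite ler_pM2l// exprS ler_peMr ?(ltW r0)//.
  by rewrite exprn_ege1.
Qed.

Theorem entire_taylor f : entire f -> exists a : nat -> R[i], forall z (e : R), 0 < e ->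
  exists N0, forall N, (N0 <= N)%N -> modc (\sum_(n < N) a n * z ^+ n - f z) < e.
Proof.
move=> /entireP df.
pose c0 := sq (fun w => w^-1) 1; have c00 : c0 != 0 by exact: sqV_neq0.
pose A n := sq (fun w => f w / w ^+ n.+1) 1.
(* Coefficients are defined on the unit square, whereas the expansion at [z] needs a square
   enclosing [z]; [sq_indep] makes the two agree. *)
exists (fun n => A n / c0) => z e e0; pose r := modc z + 1.
have zr : modc z < r by rewrite ltrDl.
have r1 : 1 <= r by rewrite lerDr modc_ge0.
have r0 : 0 < r by exact: lt_le_trans r1.
have dV n w : w != 0 -> cdiff (fun w => (w ^+ n)^-1) w.
  by move=> w0; apply: cdiffV; [rewrite expf_neq0|exact: cdiffX].
have AE n : A n = sq (fun w => f w / w ^+ n.+1) r.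
  by rewrite (sq_indep _ ltr01 r1)// => w w0; apply: cdiffM; [exact: df|exact: dV].
have CE n : (if n == 0%N then c0 else 0) = sq (fun w => 1 / w ^+ n.+1) r.
  under [in RHS]eq_fun do rewrite div1r.
  rewrite (sq_indep (dV _) ltr01 r1); case: n => [|n]; last by rewrite sqVX_eq0.
  by under [in RHS]eq_fun do rewrite expr1.
(* The expansion of the constant function 1 has coefficients c0, 0, 0, and so on, so moving the pole
   from 0 to [z] leaves the integral unchanged. *)
have c0E : sq (fun w => 1 / (w - z)) r = c0.
  apply/eqP; rewrite eq_sym -subr_eq0 -modc_eq0 eq_le modc_ge0 andbT; apply/ler_addgt0Pl => e' e'0.
  have [N0 H] := cauchy_expansion (cdiff_cst 1) zr CE e'0.
  (* The successor ensures that the sum contains its term of index 0. *)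
  have := H N0.+1 (leqnSn _); rewrite big_ord_recl/= expr0 mulr1 big1 ?addr0//.
    by move=> /ltW.
  by move=> i _; rewrite mul0r.
have dW w : r <= modc w -> cdiff (fun w => (w - z)^-1) w.
  move=> rw; apply: cdiffV; last by apply: cdiffB; [exact: cdiff_id|exact: cdiff_cst].
  by rewrite subr_eq0; apply: contraTneq rw => ->; rewrite -ltNge.
(* Cauchy's integral formula, with [c0] in the place of 2 pi i. *)
have fE : sq (fun w => f w / (w - z)) r = f z * c0.
  have := sq_dquot0 df zr; under eq_fun do rewrite mulrBl.
  rewrite sqB ?(ltW r0)//; last 2 first.
  - by move=> w rw; apply: cdiffM; [exact: df|exact: dW].
  - by move=> w rw; apply: cdiffM; [exact: cdiff_cst|exact: dW].
  rewrite sqZ ?(ltW r0)// => /eqP; rewrite subr_eq0 => /eqP ->.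
  by rewrite -c0E; under [in RHS]eq_fun do rewrite div1r.
have [|N0 H] := cauchy_expansion df zr AE (_ : 0 < e * modc c0).
  by rewrite mulr_gt0// modc_gt0.
exists N0 => N /H; rewrite fE => HN.
rewrite -(ltr_pM2r (_ : 0 < modc c0)) ?modc_gt0// -modcM mulrBl mulr_suml.
by under eq_bigr do rewrite mulrAC divfK//.
Qed.

End Taylor.

(** * Everywhere convergent power series *)

Section PowerSeries.
Variable R : realType.
Implicit Types (f g : R[i] -> R[i]) (a b u : nat -> R[i]) (r : R) (z w : R[i]).

(** Equivalent to an infinite radius of convergence. *)
Definition rapid a := forall r, 0 <= r -> exists C, forall n, modc (a n) * r ^+ n <= C.

(** Geometric convergence on discs is no restriction: [rapid] allows comparison with a disc of
    twice the radius. *)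
Definition pser a f := rapid a /\ forall r, 0 <= r -> exists2 C, 0 <= C &
  forall N z, modc z <= r -> modc (\sum_(n < N) a n * z ^+ n - f z) <= C * (2^-1) ^+ N.

Lemma sum_half (C : R) u M N : 0 <= C -> (forall n, modc (u n) <= C * (2^-1) ^+ n) ->
  (N <= M)%N ->
  modc (\sum_(n < M) u n - \sum_(n < N) u n) <= 2 * C * (2^-1) ^+ N.
Proof.
move=> C0 uC /subnK <-; move: (M - N)%N => k {M}.
(* The subtracted term makes the induction close: the bound on the next term equals the difference
   of two consecutive corrections. *)
suff : modc (\sum_(n < k + N) u n - \sum_(n < N) u n) <=
    2 * C * (2^-1) ^+ N - 2 * C * (2^-1) ^+ (k + N).
  move=> /le_trans; apply; rewrite gerBl !mulr_ge0 ?exprn_ge0//.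
elim: k => [|k ih]; first by rewrite !subrr modc0.
rewrite addSn big_ord_recr/= addrAC (le_trans (modcD _ _))//.
apply: le_trans (lerD ih (uC _)) _.
by rewrite [in leRHS]exprS le_eqVlt; apply/orP; left; apply/eqP; field.
Qed.

Lemma rapidP a r : rapid a -> 0 <= r ->
  exists2 C, 0 <= C & forall n, modc (a n) * r ^+ n <= C * (2^-1) ^+ n.
Proof.
move=> ra r0; have [C H] := ra (2 * r) ltac:(by rewrite mulr_ge0).
exists C; first by apply: le_trans (H 0%N); rewrite mulr_ge0 ?modc_ge0.
move=> n; have := H n; rewrite exprMn mulrCA exprVn -ler_pdivlMl ?exprn_gt0//.
by move=> /le_trans; apply; rewrite mulrC.
Qed.

Lemma real_series_lim (C : R) (v : nat -> R) : 0 <= C -> (forall n, `|v n| <= C * (2^-1) ^+ n) ->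
  exists l : R, (fun N => \sum_(n < N) v n) @ \oo --> l.
Proof.
move=> C0 vC; suff : cvgn (series v).
  move=> /cvg_ex[l H]; exists l.
  by rewrite (_ : (fun N => _) = series v)//; apply/funext => N; rewrite /series/= big_mkord.
apply: normed_cvg; apply: (series_le_cvg (v_ := geometric C (2^-1))) => //.
- by move=> n /=.
- by move=> n /=; rewrite mulr_ge0// exprn_ge0.
- by apply: is_cvg_geometric_series; rewrite ger0_norm// invf_lt1// ltr1n.
Qed.

Lemma half_small (C e : R) : 0 < e -> exists N0, forall N, (N0 <= N)%N -> C * (2^-1) ^+ N < e.
Proof. by apply: geometric_small; rewrite invr_ge0 ler0n/= invf_lt1 ?ltr1n. Qed.

Lemma le_half_limit (x y C : R) : (forall N, x <= y + C * (2^-1) ^+ N) -> x <= y.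
Proof.
move=> H; apply/ler_addgt0Pr => e e0; have [N HN] := half_small C e0.
by rewrite (le_trans (H N))// lerD2l ltW// HN.
Qed.

Lemma cplx_series_lim (C : R) u : 0 <= C -> (forall n, modc (u n) <= C * (2^-1) ^+ n) ->
  exists l, forall N, modc (\sum_(n < N) u n - l) <= 2 * C * (2^-1) ^+ N.
Proof.
move=> C0 uC.
have [x xP] := real_series_lim C0 (fun n => le_trans (normr_Re (u n)) (uC n)).
have [y yP] := real_series_lim C0 (fun n => le_trans (normr_Im (u n)) (uC n)).
exists (x +i* y) => N; apply/ler_addgt0Pr => e e0.
have e20 : 0 < e / 2 by rewrite divr_gt0.
have /cvgrPdist_lt/(_ _ e20)[N1 _ H1] := xP.
have /cvgrPdist_lt/(_ _ e20)[N2 _ H2] := yP.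
pose M := maxn N (maxn N1 N2).
have {}H1 := H1 M ltac:(by rewrite /= /M !leq_max leqnn !orbT).
have {}H2 := H2 M ltac:(by rewrite /= /M !leq_max leqnn !orbT).
have SR : complex.Re (\sum_(n < M) u n) = \sum_(n < M) complex.Re (u n).
  by elim/big_rec2 : _ => // i p q _ <-; rewrite cReD.
have SI : complex.Im (\sum_(n < M) u n) = \sum_(n < M) complex.Im (u n).
  by elim/big_rec2 : _ => // i p q _ <-; rewrite cImD.
have close : modc (\sum_(n < M) u n - x +i* y) <= e.
  rewrite (le_trans (modc_le_ReIm _))// cReB cImB SR SI/=.
  rewrite distrC [X in _ + X]distrC; clear -H1 H2; rewrite [e]splitr; apply: lerD; exact: ltW.
rewrite -(subrKA (\sum_(n < M) u n)) (le_trans (modcD _ _))// lerD//.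
by rewrite modcBC; apply: sum_half => //; rewrite /M leq_max leqnn.
Qed.

Lemma pser_exists a : rapid a -> exists f, pser a f.
Proof.
move=> ra.
(* The constant is quantified after the limit: [f] is chosen pointwise, yet the rate must hold with
   any constant valid on a whole disc. *)
have H z : exists l, forall C, 0 <= C -> (forall n, modc (a n * z ^+ n) <= C * (2^-1) ^+ n) ->
    forall N, modc (\sum_(n < N) a n * z ^+ n - l) <= 2 * C * (2^-1) ^+ N.
  have [C C0 CP] := rapidP ra (modc_ge0 z).
  have uC n : modc (a n * z ^+ n) <= C * (2^-1) ^+ n by rewrite modcM modcX.
  have [l lP] := cplx_series_lim C0 uC; exists l => C' C'0 uC' N.
  have [K K0] : exists K : R, forall M, modc (\sum_(n < M) a n * z ^+ n - l) <= K * (2^-1) ^+ M.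
    by exists (2 * C).
  apply: (@le_half_limit _ _ (2 * C)) => M.
  pose M' := maxn M N.
  rewrite -(subrKA (\sum_(n < M') a n * z ^+ n)) (le_trans (modcD _ _))// lerD//.
    by rewrite modcBC; apply: (sum_half C'0 uC'); rewrite leq_max leqnn orbT.
  rewrite (le_trans (lP _))// ler_wpM2l ?mulr_ge0// ler_wiXn2l ?invr_ge0 ?invf_le1 ?ler1n//.
  by rewrite leq_max leqnn.
have [f fP] := choice H.
exists f; split=> // r r0; have [C C0 CP] := rapidP ra r0.
exists (2 * C); first by rewrite mulr_ge0.
move=> N z zr; apply: fP => // n; rewrite modcM modcX; apply: le_trans (CP n).
by rewrite ler_wpM2l ?modc_ge0// lerXn2r ?nnegrE ?modc_ge0.
Qed.

(** Pointwise convergence at the real point [r] already bounds the terms |a_n| r^n; with [r]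
    arbitrary this upgrades to geometric convergence on discs. *)
Lemma entire_pser f : entire f -> exists a, pser a f.
Proof.
move=> /entire_taylor[a aP]; exists a.
have ra : rapid a.
  move=> r r0; have [N0 H] := aP r%:C 1 ltr01.
  (* From [N0] on, a term is the difference of two partial sums, each within 1 of the limit. *)
  pose K := \sum_(n < N0) modc (a n) * r ^+ n + 2.
  exists K => n; rewrite /K; have [nN|Nn] := ltnP n N0.
    rewrite (bigD1 (Ordinal nN))//= -addrA lerDl addr_ge0//.
    by apply: sumr_ge0 => i _; rewrite mulr_ge0 ?modc_ge0 ?exprn_ge0.
  apply: ler_wpDl; first by apply: sumr_ge0 => i _; rewrite mulr_ge0 ?modc_ge0 ?exprn_ge0.
  have H1 := H n Nn; have H2 := H n.+1 (leqW Nn).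
  have -> : modc (a n) * r ^+ n = modc (a n * r%:C ^+ n) by rewrite modcM modcX modcR ger0_norm.
  have -> : a n * r%:C ^+ n =
      (\sum_(n0 < n.+1) a n0 * r%:C ^+ n0 - f r%:C) -
      (\sum_(n0 < n) a n0 * r%:C ^+ n0 - f r%:C).
    by rewrite big_ord_recr/=; ring.
  by rewrite (le_trans (modcB _ _))// -[2]/(1 + 1) lerD// ltW.
split=> // r r0; have [C C0 CP] := rapidP ra r0.
exists (2 * C); first by rewrite mulr_ge0.
move=> N z zr; apply/ler_addgt0Pr => e e0; have [N0 H] := aP z e e0.
have {}H := H (maxn N0 N) (leq_maxl _ _).
rewrite -(subrKA (\sum_(n < maxn N0 N) a n * z ^+ n)).
rewrite (le_trans (modcD _ _))// lerD//; last exact: ltW.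
rewrite modcBC; apply: (@sum_half C (fun n => a n * z ^+ n)); rewrite ?leq_maxr// => n.
rewrite modcM modcX; apply: le_trans (CP n).
by rewrite ler_wpM2l ?modc_ge0// lerXn2r ?nnegrE ?modc_ge0.
Qed.

Lemma rapidB a b : rapid a -> rapid b -> rapid (fun n => a n - b n).
Proof.
move=> ra rb r r0; have [C CP] := ra r r0; have [D DP] := rb r r0.
exists (C + D) => n; apply: le_trans (lerD (CP n) (DP n)).
by rewrite -mulrDl ler_wpM2r ?exprn_ge0// modcB.
Qed.

Lemma pserB a b f g : pser a f -> pser b g -> pser (fun n => a n - b n) (fun z => f z - g z).
Proof.
move=> [ra fP] [rb gP]; split; first exact: rapidB.
move=> r r0; have [C C0 CP] := fP r r0; have [D D0 DP] := gP r r0.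
exists (C + D); first by rewrite addr_ge0.
move=> N z zr.
have -> : \sum_(n < N) (a n - b n) * z ^+ n - (f z - g z) =
  (\sum_(n < N) a n * z ^+ n - f z) - (\sum_(n < N) b n * z ^+ n - g z).
  by under eq_bigr do rewrite mulrBl; rewrite sumrB; ring.
by rewrite mulrDl (le_trans (modcB _ _))// lerD ?CP ?DP.
Qed.

Lemma rapid_scale (k : nat -> R) (M : R) a : (forall n, `|k n| <= M) -> rapid a ->
  rapid (fun n => (k n)%:C * a n).
Proof.
move=> kM ra r r0; have [C CP] := ra r r0; exists (M * C) => n.
rewrite modcM modcR -mulrA ler_pM// ?mulr_ge0 ?modc_ge0 ?exprn_ge0//.
Qed.

(** A second-order remainder whose constant can be summed against a rapid sequence, which justifies
    termwise differentiation. The condition 1 <= r allows powers of [r] to be raised, including at n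
    = 0, where [n.-1] is 0. *)
Lemma expr_quadratic r n z w : 1 <= r -> modc z <= r -> modc w <= r ->
  modc (w ^+ n - z ^+ n - n%:R * z ^+ n.-1 * (w - z)) <= n%:R ^+ 2 * r ^+ n * modc (w - z) ^+ 2.
Proof.
move=> r1 zr wr; have r0 : 0 <= r by exact: le_trans r1.
elim: n => [|n ih].
  by rewrite !expr0 subrr !mul0r subr0 modc0 expr0n/= !mul0r.
have -> : w ^+ n.+1 - z ^+ n.+1 - n.+1%:R * z ^+ n.+1.-1 * (w - z) =
  w * (w ^+ n - z ^+ n - n%:R * z ^+ n.-1 * (w - z)) + n%:R * z ^+ n.-1 * (w - z) ^+ 2.
  by case: n {ih} => [|n]; rewrite /= ?exprS -?natr1; ring.
set h := modc (w - z) in ih *; have h0 : 0 <= h by exact: modc_ge0.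
rewrite (le_trans (modcD _ _))// [modc (w * _)]modcM.
rewrite [modc (_ * (w - z) ^+ 2)]modcM modcX -/h (modcM n%:R).
have H1 : modc w * modc (w ^+ n - z ^+ n - n%:R * z ^+ n.-1 * (w - z)) <=
    r * (n%:R ^+ 2 * r ^+ n * h ^+ 2) by rewrite ler_pM ?modc_ge0.
have H2 : modc n%:R * modc (z ^+ n.-1) * h ^+ 2 <= n%:R * r ^+ n.+1 * h ^+ 2.
  rewrite ler_wpM2r ?exprn_ge0//.
  have -> : modc (n%:R : R[i]) = n%:R by rewrite -(rmorph_nat (real_complex R)) modcR ger0_norm.
  rewrite ler_wpM2l// modcX (le_trans (y := r ^+ n.-1))//.
    by rewrite lerXn2r ?nnegrE ?modc_ge0.
  by rewrite ler_weXn2l// (leq_trans (leq_pred _)).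
apply: le_trans (lerD H1 H2) _.
rewrite -natr1 (exprS r n); set q := r ^+ n.
have q0 : 0 <= r * q * h ^+ 2 by rewrite !mulr_ge0 ?exprn_ge0.
have n0 : 0 <= (n%:R : R) by [].
have : 0 <= (n%:R + 1) * (r * q * h ^+ 2) by rewrite mulr_ge0// addr_ge0.
move=> n1; rewrite -subr_ge0; apply: le_trans n1 _.
by rewrite le_eqVlt; apply/orP; left; apply/eqP; ring.
Qed.

Lemma rapid_deriv a : rapid a -> rapid (fun n => n.+1%:R * a n.+1).
Proof.
move=> ra r r0; have R0 : 0 <= 2 * (r + 1) by rewrite mulr_ge0 ?addr_ge0.
have [C CP] := ra (2 * (r + 1)) R0.
exists C => n; apply: le_trans (CP n.+1); rewrite modcM [in leRHS]mulrC -mulrA.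
have -> : modc (n.+1%:R : R[i]) = n.+1%:R by rewrite -(rmorph_nat (real_complex R)) modcR ger0_norm.
rewrite mulrCA [leRHS]mulrC ler_wpM2l ?modc_ge0// exprMn ler_pM ?exprn_ge0//.
  by rewrite -natrX ler_nat ltnW// ltn_expl.
rewrite (le_trans (y := (r + 1) ^+ n))//.
  by rewrite lerXn2r ?nnegrE ?addr_ge0// lerDl.
by rewrite ler_weXn2l// lerDr.
Qed.

Lemma pser_entire a f : pser a f -> entire f.
Proof.
move=> [ra fP]; apply/entireP => z0; pose r := modc z0 + 1.
have r1 : 1 <= r by rewrite lerDr modc_ge0.
have r0 : 0 <= r by exact: le_trans r1.
have zr : modc z0 <= r by rewrite lerDl.
have [g [_ gP]] := pser_exists (rapid_deriv ra).
have [Cf Cf0 CfP] := fP r r0; have [Cg Cg0 CgP] := gP r r0.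
(* The factor 4 absorbs the n^2 of [expr_quadratic], since n^2 <= 4^n. *)
have [K K0 KP] := rapidP ra (mulr_ge0 (ler0n _ 4) r0).
have quad w : modc w <= r -> modc (f w - f z0 - g z0 * (w - z0)) <= 2 * K * modc (w - z0) ^+ 2.
  move=> wr; set h := modc (w - z0).
  apply: (@le_half_limit _ _ (2 * Cf + Cg * h * 2)) => N.
  pose p z := \sum_(n < N.+1) a n * z ^+ n.
  pose p' := \sum_(n < N) (n.+1%:R * a n.+1) * z0 ^+ n.
  have -> : f w - f z0 - g z0 * (w - z0) = (p w - p z0 - p' * (w - z0)) -
     (p w - f w) + (p z0 - f z0) + (p' - g z0) * (w - z0) by ring.
  have B1 : modc (p w - p z0 - p' * (w - z0)) <= 2 * K * h ^+ 2.
    have -> : p w - p z0 - p' * (w - z0) =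
        \sum_(n < N.+1) a n * (w ^+ n - z0 ^+ n - n%:R * z0 ^+ n.-1 * (w - z0)).
      have -> : p' = \sum_(n < N.+1) a n * (n%:R * z0 ^+ n.-1).
        rewrite big_ord_recl/= mul0r mulr0 add0r; apply: eq_bigr => i _ /=.
        by rewrite /bump/= add1n /=; ring.
      rewrite /p mulr_suml -!sumrB; apply: eq_bigr => i _; ring.
    rewrite (le_trans (modc_sum _ _ _))//.
    apply: (@le_trans _ _ (\sum_(n < N.+1) K * (2^-1) ^+ n * h ^+ 2)).
      apply: ler_sum => i _; rewrite modcM.
      apply: (@le_trans _ _ (modc (a i) * (i%:R ^+ 2 * r ^+ i * h ^+ 2))).
        by rewrite ler_wpM2l ?modc_ge0//; exact: expr_quadratic.
      rewrite mulrA ler_wpM2r ?exprn_ge0 ?modc_ge0//; apply: le_trans (KP i).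
      rewrite ler_wpM2l ?modc_ge0// exprMn ler_wpM2r ?exprn_ge0//.
      have -> : 4 = 2 ^+ 2 :> R by rewrite -natrX.
      rewrite exprAC lerXn2r ?nnegrE ?exprn_ge0//.
      by rewrite -natrX ler_nat ltnW// ltn_expl.
    rewrite -mulr_suml ler_wpM2r ?exprn_ge0 ?modc_ge0//.
    have uK n : modc ((K * (2^-1) ^+ n)%:C) <= K * (2^-1) ^+ n.
      by rewrite modcR ger0_norm// mulr_ge0// exprn_ge0.
    have := sum_half K0 uK (leq0n N.+1); rewrite big_ord0 subr0 expr0 mulr1 -rmorph_sum/= modcR.
    by apply: le_trans; rewrite ler_norm.
  have B2 : modc (p w - f w) <= Cf * (2^-1) ^+ N.
    apply: le_trans (CfP _ _ wr) _; rewrite ler_wpM2l// ler_wiXn2l ?invr_ge0 ?invf_le1 ?ler1n//.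
  have B3 : modc (p z0 - f z0) <= Cf * (2^-1) ^+ N.
    apply: le_trans (CfP _ _ zr) _; rewrite ler_wpM2l// ler_wiXn2l ?invr_ge0 ?invf_le1 ?ler1n//.
  have B4 : modc ((p' - g z0) * (w - z0)) <= Cg * (2^-1) ^+ N * h.
    by rewrite modcM ler_wpM2r ?modc_ge0// CgP.
  have h0 : 0 <= h by exact: modc_ge0.
  have q0 : 0 <= (2^-1 : R) ^+ N by rewrite exprn_ge0.
  apply: le_trans (modcD _ _) _; apply: le_trans (lerD (modcD _ _) B4) _.
  apply: le_trans (lerD (lerD (modcB _ _) B3) (lexx _)) _.
  apply: le_trans (lerD (lerD (lerD B1 B2) (lexx _)) (lexx _)) _.
  set q := _ ^+ N in q0 *.
  have : 0 <= Cg * h * q by rewrite !mulr_ge0.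
  by clear; nra.
exists (g z0) => e e0.
exists (Num.min 1 (e / (2 * K + 1))); first by rewrite lt_min ltr01 divr_gt0// ltr_wpDl// mulr_ge0.
move=> w; rewrite lt_min ltr_pdivlMr ?ltr_wpDl ?mulr_ge0// => /andP[w0 /andP[w1 we]].
have wr : modc w <= r.
  rewrite -(subrK z0 w) (le_trans (modcD _ _))// addrC lerD2l ltW//.
have wz : w - z0 != 0 by rewrite -modc_gt0.
rewrite -(ltr_pM2r w0) -modcM mulrBl divfK//.
apply: le_lt_trans (quad w wr) _.
rewrite expr2 mulrA ltr_pM2r//; apply: le_lt_trans we.
by rewrite mulrC ler_wpM2l ?modc_ge0// lerDl.
Qed.

End PowerSeries.
(** * The Fock norm in terms of Taylor coefficients *)

Section PlanarIntegral.
Variable R : realType.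
Local Notation leb := (@lebesgue_measure R).
Local Open Scope ereal_scope.

(** The image of Lebesgue measure under a translation gives half-open intervals their length, so it
    is Lebesgue measure by uniqueness. *)
Lemma integral_shift (G : R -> \bar R) (c : R) : measurable_fun setT G ->
  (forall x, 0 <= G x) -> \int[leb]_x G (x + c)%R = \int[leb]_x G x.
Proof.
move=> mG G0; pose phi := fun x : R => (x + c)%R.
have mphi : measurable_fun [set: R] phi by apply: measurable_funD.
have := @ge0_integral_pushforward _ _ (measurableTypeR R) (measurableTypeR R) R phi mphi
  leb setT G measurableT mG (fun y _ => G0 y).
rewrite preimage_setT => <-; apply: eq_measure_integral => A mA _.
apply/esym; apply: lebesgue_measure_unique => // X [[a b] _ <-].
rewrite /= /pushforward (_ : phi @^-1` _ = `](a - c)%R, (b - c)%R]%classic); last first.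
  by apply/seteqP; split => x /=; rewrite !in_itv/= /phi ltrBlDr lerBrDr.
have H u v : leb `]u, v]%classic = if (u < v)%R then (v - u)%:E else 0.
  by apply: (etrans (lebesgue_measure_itv `]u, v]%R)); rewrite /= lte_fin EFinB.
rewrite !H ltrD2r; case: ifP => // _; congr EFin; ring.
Qed.

Lemma measurable_affine (a b : R) :
  measurable_fun [set: R * R] (fun p : R * R => a * p.1 + b * p.2)%R.
Proof.
by apply: measurable_funD; apply: measurable_funM.
Qed.

Lemma measurable_linear_map (a b c d : R) : measurable_fun [set: R * R]
  (fun p : R * R => (a * p.1 + b * p.2, c * p.1 + d * p.2)%R).
Proof. by apply: measurable_fun_pair; exact: measurable_affine. Qed.

(** With the second coordinate fixed, a shear is a translation of the first; Tonelli's theorem does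
    the rest. *)
Lemma integral_shear1 (F : R * R -> \bar R) (t : R) : measurable_fun setT F ->
  (forall p, 0 <= F p) ->
  \int[leb \x leb]_p F (p.1 + t * p.2, p.2)%R = \int[leb \x leb]_p F p.
Proof.
move=> mF F0.
have mS : measurable_fun setT (fun p : R * R => F (p.1 + t * p.2, p.2)%R).
  apply: measurableT_comp => //.
  have := measurable_linear_map 1 t 0 1; congr (measurable_fun _ _).
  by apply/funext => p; rewrite !mul1r mul0r add0r.
have E1 := @fubini_tonelli2 _ _ (measurableTypeR R) (measurableTypeR R) R leb leb _ mS
  (fun p => F0 _).
have E2 := @fubini_tonelli2 _ _ (measurableTypeR R) (measurableTypeR R) R leb leb _ mF F0.
apply: etrans E1 (etrans _ (esym E2)); apply: eq_integral => y _.
rewrite /fubini_G /=; apply: (integral_shift (G := fun x => F (x, y))) => //.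
by apply: measurableT_comp => //; exact: measurable_fun_pair.
Qed.

Lemma integral_shear2 (F : R * R -> \bar R) (t : R) : measurable_fun setT F ->
  (forall p, 0 <= F p) ->
  \int[leb \x leb]_p F (p.1, p.2 + t * p.1)%R = \int[leb \x leb]_p F p.
Proof.
move=> mF F0.
have mS : measurable_fun setT (fun p : R * R => F (p.1, p.2 + t * p.1)%R).
  apply: measurableT_comp => //.
  have := measurable_linear_map 1 0 t 1; congr (measurable_fun _ _).
  by apply/funext => p; rewrite !mul1r mul0r addr0 addrC.
have E1 := @fubini_tonelli1 _ _ (measurableTypeR R) (measurableTypeR R) R leb leb _ mS
  (fun p => F0 _).
have E2 := @fubini_tonelli1 _ _ (measurableTypeR R) (measurableTypeR R) R leb leb _ mF F0.
apply: etrans E1 (etrans _ (esym E2)); apply: eq_integral => y _.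
rewrite /fubini_F /=; apply: (integral_shift (G := fun x => F (y, x))) => //.
by apply: measurableT_comp => //; exact: measurable_fun_pair.
Qed.

Definition rot (c s : R) (p : R * R) : R * R := (c * p.1 - s * p.2, s * p.1 + c * p.2)%R.

Lemma measurable_rot c s : measurable_fun setT (rot c s).
Proof.
have := measurable_linear_map c (- s) s c; congr (measurable_fun _ _).
by apply/funext => p; rewrite /rot mulNr.
Qed.

(** A rotation is a composite of three shears; [t] is the tangent of the half angle. *)
Lemma integral_rot_neq0 (F : R * R -> \bar R) (c s : R) : measurable_fun setT F ->
  (forall p, 0 <= F p) -> (c ^+ 2 + s ^+ 2 = 1)%R -> s != 0%R ->
  \int[leb \x leb]_p F (rot c s p) = \int[leb \x leb]_p F p.
Proof.
move=> mF F0 cs s0; pose t := ((1 - c) / s)%R.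
have sE : (1 - s * t = c)%R by rewrite /t; field.
have tE : (t * (1 + c) = s)%R.
  rewrite /t mulrAC (_ : (1 - c) * (1 + c) = s * s)%R ?mulfK//.
  by rewrite (_ : s * s = 1 - c ^+ 2)%R; [ring|rewrite -cs; ring].
pose F1 p := F (p.1 - t * p.2, p.2)%R.
have mF1 : measurable_fun setT F1.
  apply: measurableT_comp => //; have := measurable_linear_map 1 (- t) 0 1.
  congr (measurable_fun _ _); apply/funext => p; by rewrite !mul1r mul0r add0r mulNr.
pose F2 p := F1 (p.1, p.2 + s * p.1)%R.
have mF2 : measurable_fun setT F2.
  apply: measurableT_comp => //; have := measurable_linear_map 1 0 s 1.
  by congr (measurable_fun _ _); apply/funext => p; rewrite !mul1r mul0r addr0 addrC.
rewrite -(integral_shear1 (- t) mF F0).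
under [RHS]eq_integral do rewrite mulNr.
rewrite -(@integral_shear2 F1 s mF1 (fun p => F0 _)).
rewrite -(@integral_shear1 F2 (- t) mF2 (fun p => F0 _)).
apply: eq_integral => -[x y] _; rewrite /F2 /F1 /rot/=; congr (F (_, _)).
- have -> : (c * x - s * y = (1 - s * t) * x - t * (1 + (1 - s * t)) * y)%R.
    by rewrite sE tE.
  ring.
- rewrite -sE; ring.
Qed.

Lemma integral_rot (F : R * R -> \bar R) (c s : R) : measurable_fun setT F ->
  (forall p, 0 <= F p) -> (c ^+ 2 + s ^+ 2 = 1)%R ->
  \int[leb \x leb]_p F (rot c s p) = \int[leb \x leb]_p F p.
Proof.
move=> mF F0 cs; have [s0|] := eqVneq s 0%R; last exact: integral_rot_neq0.
move: cs; rewrite s0 expr0n/= addr0 => /eqP; rewrite sqrf_eq1 => /orP[] /eqP ->.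
  by apply: eq_integral => -[x y] _; rewrite /rot /= !mul0r !mul1r subr0 add0r.
(* The half turn has s = 0, where the tangent of the half angle is infinite; it is treated as two
   quarter turns. *)
have q : (0 ^+ 2 + 1 ^+ 2 = 1 :> R)%R by rewrite expr0n expr1n add0r.
pose F1 p := F (rot 0 1 p).
have mF1 : measurable_fun setT F1 by apply: measurableT_comp => //; exact: measurable_rot.
rewrite -(integral_rot_neq0 mF F0 q (oner_neq0 _)).
rewrite -(@integral_rot_neq0 F1 0 1 mF1 (fun p => F0 _) q (oner_neq0 _)).
by apply: eq_integral => -[x y] _; rewrite /F1 /rot/=; congr (F (_, _)); ring.
Qed.

Lemma fatou_le (F_ : nat -> R * R -> R) (F : R * R -> R) (B : \bar R) :
  (forall n, measurable_fun setT (F_ n)) -> (forall n p, (0 <= F_ n p)%R) ->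
  (forall p, F_ ^~ p @ \oo --> F p) ->
  (forall n, \int[leb \x leb]_p (F_ n p)%:E <= B) ->
  \int[leb \x leb]_p (F p)%:E <= B.
Proof.
move=> mF F0 FF FB.
have := @fatou _ _ R (leb \x leb) setT measurableT (fun n p => (F_ n p)%:E).
have mE n : measurable_fun setT (fun p => (F_ n p)%:E) by apply/measurable_EFinP; exact: mF.
move=> /(_ mE).
have F0' n x : setT x -> 0 <= (F_ n x)%:E by rewrite lee_fin.
move=> /(_ F0') H; apply: le_trans (le_trans H _); last first.
  rewrite limn_einf_lim; apply: lime_le; first exact: is_cvg_einfs.
  apply: nearW => n; apply: le_trans (FB n).
  by apply: ereal_inf_lbound; exists n => //=.
rewrite le_eqVlt; apply/orP; left; apply/eqP; apply: eq_integral => p _.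
apply/esym; have /cvg_limn_einf_sup[-> _]// : (F_ n p)%:E @[n --> \oo] --> (F p)%:E.
by apply: cvg_EFin; [exact: nearW|exact: FF].
Qed.

End PlanarIntegral.

(** * Measurability of complex-valued functions *)

Section ComplexMeasurable.
Context d (T : measurableType d) (R : realType) (D : set T).
Implicit Types (g h : T -> R[i]).

Definition cmeas g := measurable_fun D (fun x => complex.Re (g x)) /\
  measurable_fun D (fun x => complex.Im (g x)).

Lemma cmeas_cst (k : R[i]) : cmeas (fun=> k).
Proof. by split; exact: measurable_cst. Qed.

Lemma cmeasD g h : cmeas g -> cmeas h -> cmeas (fun x => g x + h x).
Proof.
move=> [gr gi] [hr hi]; split.
- by under eq_fun do rewrite cReD; exact: measurable_funD.
- by under eq_fun do rewrite cImD; exact: measurable_funD.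
Qed.

Lemma cmeasM g h : cmeas g -> cmeas h -> cmeas (fun x => g x * h x).
Proof.
move=> [gr gi] [hr hi]; split.
- by under eq_fun do rewrite cReM; apply: measurable_funB; exact: measurable_funM.
- by under eq_fun do rewrite cImM; apply: measurable_funD; exact: measurable_funM.
Qed.

Lemma cmeasX g n : cmeas g -> cmeas (fun x => g x ^+ n).
Proof.
move=> mg; elim: n => [|n ih]; first exact: cmeas_cst.
by under eq_fun do rewrite exprS; exact: cmeasM.
Qed.

Lemma cmeas_poly g (a : nat -> R[i]) N : cmeas g ->
  cmeas (fun x => \sum_(n < N) a n * g x ^+ n).
Proof.
move=> mg; elim: N => [|N ih].
  by under eq_fun do rewrite big_ord0; exact: cmeas_cst.
under eq_fun do rewrite big_ord_recr/=.
by apply: cmeasD => //; apply: cmeasM; [exact: cmeas_cst|exact: cmeasX].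
Qed.

Lemma cmeas_pser g (a : nat -> R[i]) f : pser a f -> cmeas g -> cmeas (fun x => f (g x)).
Proof.
move=> [_ fP] mg.
have cv (P : R[i] -> R) x : (forall z w, `|P z - P w| <= modc (z - w)) ->
    (fun N => P (\sum_(n < N) a n * g x ^+ n)) @ \oo --> P (f (g x)).
  move=> PL; have [C C0 H] := fP _ (modc_ge0 (g x)).
  apply/cvgrPdist_lt => e e0; have [N0 HN] := half_small C e0.
  exists N0 => // N /= /HN; apply: le_lt_trans; rewrite distrC (le_trans (PL _ _))//.
  exact: H.
split.
  apply: (@measurable_fun_cvg _ _ _ D (fun N x => complex.Re (\sum_(n < N) a n * g x ^+ n))).
- by move=> N; have [] := cmeas_poly a N mg.
- by move=> x _; apply: cv => z w; rewrite -cReB normr_Re.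
  apply: (@measurable_fun_cvg _ _ _ D (fun N x => complex.Im (\sum_(n < N) a n * g x ^+ n))).
- by move=> N; have [] := cmeas_poly a N mg.
- by move=> x _; apply: cv => z w; rewrite -cImB normr_Im.
Qed.

Lemma cmeas_sqr_modc g : cmeas g -> measurable_fun D (fun x => modc (g x) ^+ 2).
Proof.
move=> [gr gi]; under eq_fun do rewrite sqr_modc.
by apply: measurable_funD; exact: measurable_funX.
Qed.

End ComplexMeasurable.

(** * The planar Gaussian measure and the norms of monomials *)

Section GaussianWeights.
Variables (R : realType) (alpha : R).
Hypothesis alpha_gt0 : 0 < alpha.
Local Notation leb := (@lebesgue_measure R).
Implicit Types (h : R * R -> R).

Definition cpt (p : R * R) : R[i] := p.1 +i* p.2.

Lemma cmeas_cpt : cmeas setT cpt.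
Proof. by split; [exact: measurable_fst|exact: measurable_snd]. Qed.

Lemma sqr_modc_cpt p : modc (cpt p) ^+ 2 = p.1 ^+ 2 + p.2 ^+ 2.
Proof. by rewrite sqr_modc. Qed.

Definition gw (p : R * R) := expR (- alpha * (p.1 ^+ 2 + p.2 ^+ 2)).

Lemma gw_ge0 p : 0 <= gw p. Proof. exact: expR_ge0. Qed.

Lemma measurable_gw : measurable_fun setT gw.
Proof.
apply: measurableT_comp => //; apply: measurable_funM => //.
by apply: measurable_funD; apply: measurable_funX.
Qed.

Lemma cst_gt0 : 0 < alpha / pi.
Proof. by rewrite divr_gt0// pi_gt0. Qed.

(** Extends the Fock norm from |f|^2 to real functions on the plane, because the averages and
    truncations met later are not squared moduli of entire functions. *)
Definition gI h : \bar R :=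
  ((alpha / pi)%:E * \int[leb \x leb]_p (h p * gw p)%:E)%E.

Definition nnm h := measurable_fun setT h /\ forall p, 0 <= h p.

Lemma nnm_gw h : nnm h -> measurable_fun setT (fun p => (h p * gw p)%:E).
Proof.
by move=> [mh _]; apply/measurable_EFinP; apply: measurable_funM => //; exact: measurable_gw.
Qed.

Lemma nnm_gw_ge0 h p : nnm h -> (0 <= (h p * gw p)%:E)%E.
Proof. by move=> [_ h0]; rewrite lee_fin mulr_ge0// gw_ge0. Qed.

Lemma eq_gI h h' : h =1 h' -> gI h = gI h'.
Proof. by move=> hh; congr (_ * _)%E; apply: eq_integral => p _; rewrite hh. Qed.

Lemma gI_ge0 h : nnm h -> (0 <= gI h)%E.
Proof.
move=> hh; apply: mule_ge0; first by rewrite lee_fin ltW// cst_gt0.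
by apply: integral_ge0 => p _; exact: nnm_gw_ge0.
Qed.

Lemma gI_le h h' : nnm h -> nnm h' -> (forall p, h p <= h' p) -> (gI h <= gI h')%E.
Proof.
move=> nh nh' hh; apply: lee_wpmul2l; first by rewrite lee_fin ltW// cst_gt0.
apply: ge0_le_integral => //; [by move=> p _; exact: nnm_gw_ge0|exact: nnm_gw|exact: nnm_gw|].
by move=> p _; rewrite lee_fin ler_wpM2r ?gw_ge0.
Qed.

Lemma nnm_sum (I : Type) (s : seq I) (h_ : I -> R * R -> R) : (forall i, nnm (h_ i)) ->
  nnm (fun p => \sum_(i <- s) h_ i p).
Proof.
move=> nh; split; last by move=> p; apply: sumr_ge0 => i _; case: (nh i) => _; exact.
elim: s => [|i s ih]; first by under eq_fun do rewrite big_nil; exact: measurable_cst.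
by under eq_fun do rewrite big_cons; apply: measurable_funD => //; case: (nh i).
Qed.

Lemma gI_sum (I : Type) (s : seq I) (h_ : I -> R * R -> R) : (forall i, nnm (h_ i)) ->
  gI (fun p => \sum_(i <- s) h_ i p) = (\sum_(i <- s) gI (h_ i))%E.
Proof.
move=> nh; rewrite /gI -ge0_sume_distrr; last first.
  by move=> i _; apply: integral_ge0 => p _; exact: nnm_gw_ge0.
congr (_ * _)%E; rewrite -ge0_integral_sum//; last 2 first.
- by move=> i; exact: nnm_gw.
- by move=> i p _; exact: nnm_gw_ge0.
by apply: eq_integral => p _; rewrite mulr_suml -sumEFin.
Qed.

Lemma gI_scale (k : R) h : 0 <= k -> nnm h -> gI (fun p => k * h p) = (k%:E * gI h)%E.
Proof.
move=> k0 nh; rewrite /gI muleCA; congr (_ * _)%E.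
rewrite -ge0_integralZl//; last 2 first.
- exact: nnm_gw.
- by move=> p _; exact: nnm_gw_ge0.
by apply: eq_integral => p _; rewrite -mulrA.
Qed.

Lemma nnm_scale k h : 0 <= k -> nnm h -> nnm (fun p => k * h p).
Proof.
by move=> k0 [mh h0]; split; [exact: measurable_funM|move=> p; rewrite mulr_ge0].
Qed.

Lemma gI_fatou (h_ : nat -> R * R -> R) h (B : R) : (forall n, nnm (h_ n)) ->
  (forall p, h_ ^~ p @ \oo --> h p) -> (forall n, (gI (h_ n) <= B%:E)%E) -> (gI h <= B%:E)%E.
Proof.
move=> nh hh hB; have c0 := cst_gt0.
rewrite /gI -lee_pdivlMl//; apply: (@fatou_le _ (fun n p => h_ n p * gw p)).
- by move=> n; apply/measurable_EFinP; exact: nnm_gw.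
- by move=> n p; rewrite -lee_fin; exact: nnm_gw_ge0.
- by move=> p; apply: cvgM; [exact: hh|exact: cvg_cst].
- by move=> n; rewrite lee_pdivlMl//; exact: hB.
Qed.

Lemma nnm_sqr_modc g : cmeas setT g -> nnm (fun p => modc (g p) ^+ 2).
Proof. by move=> mg; split; [exact: cmeas_sqr_modc|move=> p; exact: sqr_ge0]. Qed.

Lemma fock_gI f : fock_norm2 alpha f = gI (fun p => modc (f (cpt p)) ^+ 2).
Proof. by []. Qed.

Lemma fock_rot f (u : R[i]) : modc u = 1 -> cmeas setT (fun p => f (cpt p)) ->
  fock_norm2 alpha (fun z => f (u * z)) = fock_norm2 alpha f.
Proof.
move=> u1 mf; have nf := nnm_sqr_modc mf; rewrite !fock_gI /gI; congr (_ * _)%E.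
have cs : complex.Re u ^+ 2 + complex.Im u ^+ 2 = 1 by rewrite -sqr_modc u1 expr1n.
rewrite -(integral_rot (nnm_gw nf) (fun p => nnm_gw_ge0 p nf) cs).
apply: eq_integral => p _; congr (modc (f _) ^+ 2 * _)%:E.
  case: (u) => c s; rewrite /cpt /rot; apply/eqP; rewrite eq_complex/=.
  by apply/andP; split; apply/eqP; ring.
rewrite /gw /rot/=; congr (expR (_ * _)).
by rewrite -[LHS]mul1r -cs; ring.
Qed.

Lemma integral_gauss_lty (b : R) : 0 < b -> (\int[leb]_x (expR (- b * x ^+ 2))%:E < +oo)%E.
Proof.
(* Variance 1 / (2 b): the normal density is then a positive multiple of the integrand, and its
   total mass 1 excludes an infinite integral. *)
move=> b0; pose s := Num.sqrt (b^-1 / 2).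
have s2 : s ^+ 2 = b^-1 / 2 by rewrite sqr_sqrtr// divr_ge0// invr_ge0 ltW.
have s0 : s != 0 by rewrite gt_eqF// sqrtr_gt0 divr_gt0// invr_gt0.
have := @integral_normal_pdf R 0 s; rewrite normal_pdfE//.
have k0 := normal_peak_gt0 s0.
have mE : measurable_fun [set: R] (fun x : R => (expR (- b * x ^+ 2))%:E).
  apply/measurable_EFinP; apply: measurableT_comp => //.
  by apply: measurable_funM => //; exact: measurable_funX.
under eq_integral.
  move=> x _; have -> : normal_fun 0 s x = expR (- b * x ^+ 2).
    rewrite /normal_fun subr0 s2; congr expR.
    by rewrite -[_ *+ 2]mulr_natr divfK// invrK mulNr mulrC mulNr.
  rewrite EFinM; over.
rewrite ge0_integralZl//; last by rewrite lee_fin ltW.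
move=> H; rewrite ltey; apply/eqP => K; move: H.
by rewrite [X in (_ * X)%E](_ : _ = +oo%E)// gt0_muley// lte_fin.
Qed.

Definition wgt n : \bar R := fock_norm2 alpha (fun z => z ^+ n).

Lemma wgtE n : wgt n = gI (fun p => (p.1 ^+ 2 + p.2 ^+ 2) ^+ n).
Proof.
rewrite /wgt fock_gI; apply: eq_gI => p.
by rewrite modcX -sqr_modc_cpt exprAC.
Qed.

Lemma nnm_modX n : nnm (fun p : R * R => (p.1 ^+ 2 + p.2 ^+ 2) ^+ n).
Proof.
split; last by move=> p; rewrite exprn_ge0// addr_ge0// sqr_ge0.
by apply: measurable_funX; apply: measurable_funD; exact: measurable_funX.
Qed.

Lemma expR_ge_term (y : R) n : 0 <= y -> y ^+ n / n`!%:R <= expR y.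
Proof.
move=> y0; case: n => [|n]; first by rewrite expr0 fact0 divr1 -expR0 ler_expR.
by apply: le_trans (expR_ge1Dxn n y0); rewrite lerDr.
Qed.

Lemma wgt_lty n : (wgt n < +oo)%E.
Proof.
rewrite wgtE /gI; apply: lte_mul_pinfty; [by rewrite lee_fin ltW// cst_gt0|by []|].
(* Half of the exponent pays for the polynomial factor: (b q)^n / n! <= exp(b q) bounds q^n exp(-
   alpha q) by C exp(- b q), a product of one-variable Gaussians. *)
pose b := alpha / 2; have b0 : 0 < b by rewrite divr_gt0.
pose C := n`!%:R / b ^+ n; have C0 : 0 <= C by rewrite divr_ge0// exprn_ge0// ltW.
have mb : measurable_fun setT (fun x : R => expR (- b * x ^+ 2)).
  apply: measurableT_comp => //.
  by apply: measurable_funM => //; exact: measurable_funX.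
pose G (p : R * R) := (C * expR (- b * p.1 ^+ 2) * expR (- b * p.2 ^+ 2))%:E.
have mG : measurable_fun setT G.
  apply/measurable_EFinP; apply: measurable_funM; last first.
    exact: (measurableT_comp mb measurable_snd).
  by apply: measurable_funM => //; exact: (measurableT_comp mb measurable_fst).
have G0 p : (0 <= G p)%E by rewrite lee_fin; apply: mulr_ge0; [apply: mulr_ge0|]; rewrite ?expR_ge0.
apply: (@le_lt_trans _ _ (\int[leb \x leb]_p G p)%E).
  apply: ge0_le_integral => //.
  - by move=> p _; exact: (nnm_gw_ge0 p (nnm_modX n)).
  - exact: (nnm_gw (nnm_modX n)).
  move=> p _; rewrite lee_fin /gw; set q := p.1 ^+ 2 + p.2 ^+ 2.
  have q0 : 0 <= q by rewrite addr_ge0// sqr_ge0.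
  rewrite -mulrA -expRD -mulrDr -/q.
  have -> : - alpha * q = b * q * -1 + - b * q by rewrite /b; field.
  rewrite expRD mulrA ler_wpM2r ?expR_ge0// mulrN1 expRN ler_pdivrMr ?expR_gt0//.
  have := expR_ge_term n (mulr_ge0 (ltW b0) q0).
  rewrite exprMn /C -ler_pdivrMl ?divr_gt0 ?exprn_gt0// ?ltr0n ?fact_gt0//.
  by congr (_ <= _); rewrite invfM invrK; ring.
have := @fubini_tonelli1 _ _ (measurableTypeR R) (measurableTypeR R) R leb leb _ mG G0.
move=> ->; rewrite /fubini_F /G.
have inner x : (\int[leb]_y (C * expR (- b * x ^+ 2) * expR (- b * y ^+ 2))%:E =
   (C * expR (- b * x ^+ 2))%:E * \int[leb]_y (expR (- b * y ^+ 2))%:E)%E.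
  rewrite -ge0_integralZl//.
  - by apply/measurable_EFinP.
  - by rewrite lee_fin; apply: mulr_ge0; rewrite ?expR_ge0.
under eq_integral do rewrite /= inner.
have I0 : (0 <= \int[leb]_y (expR (- b * y ^+ 2))%:E)%E.
  by apply: integral_ge0 => y _; rewrite lee_fin expR_ge0.
have := integral_gauss_lty b0.
move: I0; set I := (\int[leb]_y _)%E => I0 Ifin.
under eq_integral do rewrite muleC EFinM muleA.
rewrite ge0_integralZl//.
- apply: lte_mul_pinfty; last exact: (integral_gauss_lty b0).
    by rewrite mule_ge0.
  by rewrite fin_numM// ge0_fin_numE.
- by apply/measurable_EFinP.
- by rewrite mule_ge0.
Qed.

Definition W n : R := fine (wgt n).

Lemma wgtW n : wgt n = (W n)%:E.
Proof.
by rewrite fineK// ge0_fin_numE ?wgt_lty// wgtE; apply: gI_ge0; exact: nnm_modX.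
Qed.

(** The integral is restricted to the unit square [r, r+1] x [0, 1], on which |z| >= r and the
    Gaussian is at least [m], uniformly in [n]. *)
Lemma W_ge r : 0 <= r -> exists2 c, 0 < c & forall n, c * (r ^+ n) ^+ 2 <= W n.
Proof.
move=> r0; pose m := expR (- alpha * ((r + 1) ^+ 2 + 1)).
exists (alpha / pi * m); first by rewrite mulr_gt0 ?cst_gt0 ?expR_gt0.
move=> n; rewrite -lee_fin -wgtW wgtE /gI -(mulrA (alpha / pi)) EFinM.
apply: lee_wpmul2l; first by rewrite lee_fin ltW// cst_gt0.
pose Q : set (R * R) := `[r, r + 1]%classic `*` `[0, 1]%classic.
have mQ : measurable Q by apply: measurableX; exact: measurable_itv.
have lebQ : (leb \x leb)%E Q = 1%E.
  have := @product_measure1E _ _ (measurableTypeR R) (measurableTypeR R) R leb leb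
    `[r, r + 1]%classic `[0, 1]%classic (measurable_itv _) (measurable_itv _).
  move=> ->; rewrite [X in (X * _)%E](_ : _ = 1%E); last first.
    apply: etrans (lebesgue_measure_itv `[r, (r + 1)]%R) _.
    by rewrite /= lte_fin ltrDl ltr01 -EFinB addrAC subrr add0r.
  rewrite mul1e; apply: etrans (lebesgue_measure_itv `[0, 1]%R) _.
  by rewrite /= lte_fin ltr01 sube0.
have k0 : 0 <= m * (r ^+ n) ^+ 2 by rewrite mulr_ge0 ?expR_ge0 ?sqr_ge0.
have -> : (m * (r ^+ n) ^+ 2)%:E = (\int[leb \x leb]_p ((m * (r ^+ n) ^+ 2)%:E * (\1_Q p)%:E))%E.
  rewrite ge0_integralZl//.
    rewrite [X in (_ * X)%E](_ : _ = 1%E) ?mule1//.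
    by apply: etrans lebQ; apply: etrans (integral_indic _ _ _) _ => //; rewrite setIT.
  by apply/measurable_EFinP.
apply: ge0_le_integral => //.
- by move=> p _; apply: mule_ge0; rewrite lee_fin.
- by apply: emeasurable_funM => //; apply/measurable_EFinP.
- exact: (nnm_gw (nnm_modX n)).
move=> p _; rewrite -EFinM lee_fin indicE; case: (boolP (p \in Q)) => [|_]; last first.
  by rewrite mulr0 mulr_ge0 ?gw_ge0//; case: (nnm_modX n).
rewrite inE /Q /= !in_itv/= => -[/andP[p1 p2] /andP[p3 p4]].
rewrite mulr1 mulrC exprAC ler_pM ?exprn_ge0 ?expR_ge0//.
  rewrite lerXn2r ?nnegrE ?sqr_ge0 ?addr_ge0 ?sqr_ge0//.
  apply: (@le_trans _ _ (p.1 ^+ 2)); last by rewrite lerDl sqr_ge0.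
  by rewrite lerXn2r ?nnegrE// (le_trans r0).
rewrite ler_expR !mulNr lerN2 ler_wpM2l ?(ltW alpha_gt0)// lerD//.
  by rewrite lerXn2r ?nnegrE ?(le_trans r0 p1) ?addr_ge0.
by rewrite expr_le1.
Qed.

Lemma W_gt0 n : 0 < W n.
Proof.
by have [c c0 /(_ n)] := W_ge ler01; rewrite !expr1n mulr1; exact: lt_le_trans.
Qed.

End GaussianWeights.

(** * Parseval's identity in the form of two inequalities *)

Section Parseval.
Variables (R : realType) (alpha : R).
Hypothesis alpha_gt0 : 0 < alpha.
Implicit Types (a : nat -> R[i]) (f : R[i] -> R[i]) (N K : nat).
Local Notation W := (W alpha).
Local Notation gI := (gI alpha).

(** X^N - 1 splits over [R[i]] and is separable in characteristic 0; its N distinct roots include a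
    primitive one. *)
Lemma prim_root_exists N : (0 < N)%N -> exists om : R[i], N.-primitive_root om.
Proof.
move=> N0; pose p : {poly R[i]} := 'X^N - 1; have [r Dp] := closed_field_poly_normal p.
rewrite (monicP _) ?monicXnsubC // scale1r in Dp.
have rn1 : all N.-unity_root r by apply/allP=> z; rewrite -root_prod_XsubC -Dp.
have sz_r : (N < (size r).+1)%N by rewrite -(size_prod_XsubC r id) -Dp size_XnsubC.
have [|z _ zP] := hasP (has_prim_root N0 rn1 _ sz_r); last by exists z.
by rewrite -separable_prod_XsubC -Dp separable_Xn_sub_1 // pnatr_eq0 -lt0n.
Qed.

Lemma modc_prim_root N (om : R[i]) : N.-primitive_root om -> modc om = 1.
Proof.
move=> oP; have N0 := prim_order_gt0 oP; apply/eqP.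
rewrite -(pexpr_eq1 N0 (modc_ge0 om)) -modcX (prim_expr_order oP) modc1//.
Qed.

(** After expansion, the pair (n, m) carries the sum over j of x^j with x = om^n conj(om)^m. It
    equals N for n = m and is a vanishing geometric sum otherwise, because degrees below N keep the
    powers of [om] distinct. *)
Lemma unity_avg N (om : R[i]) a z : N.-primitive_root om ->
  \sum_(j < N) modc (\sum_(n < N) a n * (om ^+ j * z) ^+ n) ^+ 2 =
  N%:R * \sum_(n < N) modc (a n) ^+ 2 * (modc z ^+ 2) ^+ n.
Proof.
move=> oP; have N0 := prim_order_gt0 oP; have om1 := modc_prim_root oP.
have omc : om * om^*%C = 1 by rewrite -sqr_normc modcE om1 -rmorphXn expr1n.
have sqE (w : R[i]) : (modc w ^+ 2)%:C = w * w^*%C by rewrite -sqr_normc modcE rmorphXn.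
apply: complexI; rewrite rmorph_sum/= rmorphM/= rmorph_nat rmorph_sum/=.
pose b n := a n * z ^+ n.
have L (j : 'I_N) : (modc (\sum_(n < N) a n * (om ^+ j * z) ^+ n) ^+ 2)%:C =
    \sum_(n < N) \sum_(m < N) b n * (b m)^*%C * (om ^+ n * (om^*%C) ^+ m) ^+ j.
  rewrite sqE rmorph_sum/= mulr_suml; apply: eq_bigr => n _.
  rewrite mulr_sumr; apply: eq_bigr => m _.
  rewrite /b !rmorphM/= !rmorphXn/= !rmorphM/= !rmorphXn/= !exprMn -!exprM.
  by rewrite [(n * j)%N]mulnC [(m * j)%N]mulnC; ring.
under eq_bigr do rewrite L.
rewrite exchange_big/= mulr_sumr; apply: eq_bigr => n _.
rewrite exchange_big/= (bigD1 n)//= [X in _ + X]big1 ?addr0.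
  have -> : om ^+ n * om^*%C ^+ n = 1 by rewrite -exprMn omc expr1n.
  under eq_bigr do rewrite expr1n mulr1.
  rewrite sumr_const card_ord -[LHS]mulr_natl; congr (_ * _).
  by rewrite -sqE /b modcM modcX exprMn exprAC.
move=> m mn; rewrite -mulr_sumr.
set x := om ^+ n * om^*%C ^+ m.
have x1 : x != 1.
  apply: contra mn => /eqP xe; have : om ^+ n == om ^+ m.
    have : x * om ^+ m = om ^+ m by rewrite xe mul1r.
    by rewrite /x -mulrA -exprMn [om^*%C * _]mulrC omc expr1n mulr1 => ->.
  rewrite (eq_prim_root_expr oP) !modn_small//.
  by rewrite eq_sym.
have xN : x ^+ N = 1.
  rewrite /x exprMn -!exprM ![(_ * N)%N]mulnC !exprM -rmorphXn/= (prim_expr_order oP).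
  by rewrite rmorph1 !expr1n mulr1.
have := subrX1 x N; rewrite xN subrr => /esym/eqP.
by rewrite mulf_eq0 subr_eq0 (negbTE x1)/= => /eqP ->; rewrite mulr0.
Qed.

Lemma nnm_poly N a : nnm (fun p => \sum_(n < N) modc (a n) ^+ 2 * (modc (@cpt R p) ^+ 2) ^+ n).
Proof.
apply: nnm_sum => n; apply: nnm_scale; first exact: sqr_ge0.
by have := nnm_modX R n; congr nnm; apply/funext => p; rewrite sqr_modc_cpt.
Qed.

Lemma gI_poly N a :
  gI (fun p => \sum_(n < N) modc (a n) ^+ 2 * (modc (@cpt R p) ^+ 2) ^+ n) =
  (\sum_(n < N) modc (a n) ^+ 2 * W n)%:E.
Proof.
rewrite gI_sum//; last first.
  move=> n; apply: nnm_scale; first exact: sqr_ge0.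
  by have := nnm_modX R n; congr nnm; apply/funext => p; rewrite sqr_modc_cpt.
rewrite -sumEFin; apply: eq_bigr => n _; rewrite gI_scale ?sqr_ge0//; last first.
  by have := nnm_modX R n; congr nnm; apply/funext => p; rewrite sqr_modc_cpt.
rewrite [in RHS]EFinM -(wgtW alpha_gt0) wgtE; congr (_ * _)%E; apply: eq_gI => p.
by rewrite sqr_modc_cpt.
Qed.

Lemma gI_avg N (om : R[i]) f : N.-primitive_root om -> cmeas setT (fun p => f (@cpt R p)) ->
  (forall u, cmeas setT (fun p => f (u * @cpt R p))) ->
  gI (fun p => N%:R^-1 * \sum_(j < N) modc (f (om ^+ j * cpt p)) ^+ 2) = fock_norm2 alpha f.
Proof.
move=> oP mf mfu; have N0 := prim_order_gt0 oP; have om1 := modc_prim_root oP.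
have nn (j : 'I_N) : nnm (fun p => modc (f (om ^+ j * @cpt R p)) ^+ 2).
  by apply: nnm_sqr_modc.
rewrite gI_scale//; last exact: nnm_sum.
rewrite gI_sum//.
rewrite (eq_bigr (fun=> fock_norm2 alpha f)); last first.
  by move=> j _; apply: (@fock_rot R alpha f (om ^+ j)) => //; rewrite modcX om1 expr1n.
rewrite sumr_const card_ord.
have f0 : (0 <= fock_norm2 alpha f)%E by apply: gI_ge0 => //; exact: nnm_sqr_modc.
rewrite -[X in (_ * X)%E]mule_natl muleA -EFinM mulVf ?mul1e//.
by rewrite pnatr_eq0 -lt0n.
Qed.

Lemma fock_poly N a : fock_norm2 alpha (fun z => \sum_(n < N) a n * z ^+ n) =
  (\sum_(n < N) modc (a n) ^+ 2 * W n)%:E.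
Proof.
case: N => [|N].
  rewrite fock_gI -(gI_poly 0 a); apply: eq_gI => p.
  by rewrite !big_ord0 modc0 expr0n.
have [om oP] := prim_root_exists (ltn0Sn N).
rewrite -(gI_avg oP); last 2 first.
- by apply: cmeas_poly; exact: cmeas_cpt.
- by move=> u; apply: cmeas_poly; apply: cmeasM; [exact: cmeas_cst|exact: cmeas_cpt].
by rewrite -gI_poly; apply: eq_gI => p; rewrite (unity_avg _ _ oP) mulKf// pnatr_eq0.
Qed.

Lemma cmeas_pser_cpt a f (u : R[i]) : pser a f -> cmeas setT (fun p => f (u * @cpt R p)).
Proof.
by move=> fP; apply: (cmeas_pser fP); apply: cmeasM; [exact: cmeas_cst|exact: cmeas_cpt].
Qed.

Lemma cmeas_pser_cpt1 a f : pser a f -> cmeas setT (fun p => f (@cpt R p)).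
Proof. by move=> fP; apply: (cmeas_pser fP); exact: cmeas_cpt. Qed.

(** Fatou's lemma along the Taylor polynomials, whose norms are known exactly from [fock_poly]. *)
Lemma fock_le_coef a f (B : R) : pser a f ->
  (forall K, \sum_(n < K) modc (a n) ^+ 2 * W n <= B) -> (fock_norm2 alpha f <= B%:E)%E.
Proof.
move=> fP HB; rewrite fock_gI.
apply: (gI_fatou alpha_gt0 (h_ := fun N p => modc (\sum_(n < N) a n * cpt p ^+ n) ^+ 2)).
- by move=> N; apply: nnm_sqr_modc; apply: cmeas_poly; exact: cmeas_cpt.
- move=> p; rewrite [X in _ --> X]expr2; under eq_fun do rewrite expr2.
  suff H : (fun N => modc (\sum_(n < N) a n * cpt p ^+ n)) @ \oo --> modc (f (cpt p)).
    by apply: cvgM.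
  have [C C0 H] := fP.2 _ (modc_ge0 (cpt p)).
  apply/cvgrPdist_lt => e e0; have [N0 HN] := half_small C e0.
  exists N0 => // N /= /HN; apply: le_lt_trans; apply: le_trans (H N _ (lexx _)).
  by rewrite distrC ler_norml lerNl opprB modc_lerB modcBC modc_lerB.
- by move=> N; have := fock_poly N a; rewrite fock_gI => ->; rewrite lee_fin.
Qed.

(** Averaging [|f|^2] over the rotations by [N]-th roots of unity changes neither the norm nor,
    up to [O(2^-N)], the sum of the first [N] squared coefficients. Truncating the averages [A k]
    at [S] makes them converge pointwise to [S], so that Fatou's lemma applies. *)
Lemma coef_le_fock a f (B : R) K : pser a f -> (fock_norm2 alpha f <= B%:E)%E ->
  \sum_(n < K) modc (a n) ^+ 2 * W n <= B.
Proof.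
move=> fP fB; rewrite -lee_fin -gI_poly.
(* The order is positive, exceeds [K] so that the average sees every term of [S], and exceeds [k] so
   that the Taylor error is at most of order 2^-k. *)
have /choice[om oP] : forall k, exists om : R[i], (K + k.+1).-primitive_root om.
  by move=> k; apply: prim_root_exists; rewrite addnS.
pose S p := \sum_(n < K) modc (a n) ^+ 2 * (modc (@cpt R p) ^+ 2) ^+ n.
pose A k p := (K + k.+1)%:R^-1 * \sum_(j < K + k.+1) modc (f (om k ^+ j * @cpt R p)) ^+ 2.
have nA k : nnm (A k).
  apply: nnm_scale => //; apply: nnm_sum => j.
  by apply: nnm_sqr_modc; exact: cmeas_pser_cpt fP.
have nS : nnm S by exact: nnm_poly.
apply: (gI_fatou alpha_gt0 (h_ := fun k p => Num.min (A k p) (S p))).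
- move=> k; split; first by apply: measurable_minr; [case: (nA k)|case: nS].
  by move=> p; rewrite le_min; case: (nA k) => _ ->; case: nS => _ ->.
- move=> p; set r := modc (@cpt R p).
  have [C C0 H] := fP.2 _ (modc_ge0 (@cpt R p)); rewrite -/r in H.
  (* For the Taylor polynomial of length N the average is exact and dominates [S p]. Passing to [f]
     costs at most 4 C^2 q at each rotated point, since |P| <= |f u| + C q and |P| <= 2 C. *)
  have low k : S p - 4 * C ^+ 2 * (2^-1) ^+ k <= A k p.
    set N := (K + k.+1)%N; set q : R := (2^-1) ^+ k.
    have N0 : 0 < N%:R :> R by rewrite ltr0n /N addnS.
    have om1 := modc_prim_root (oP k).
    have q0 : 0 <= q by rewrite exprn_ge0.
    apply: (@le_trans _ _ (\sum_(n < N) modc (a n) ^+ 2 * (r ^+ 2) ^+ n - 4 * C ^+ 2 * q)).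
      rewrite lerD2r /N big_split_ord/= lerDl; apply: sumr_ge0 => i _.
      by rewrite mulr_ge0 ?sqr_ge0// exprn_ge0// sqr_ge0.
    rewrite /A -/N ler_pdivlMl// mulrBr -(unity_avg _ _ (oP k)) -/N lerBlDr.
    have -> : N%:R * (4 * C ^+ 2 * q) = \sum_(j < N) 4 * C ^+ 2 * q.
      by rewrite sumr_const card_ord mulr_natl.
    rewrite -big_split/=; apply: ler_sum => j _.
    set u := om k ^+ j * cpt p; have ur : modc u <= r by rewrite /u modcM modcX om1 expr1n mul1r.
    set P := \sum_(n < N) _.
    have H0 : modc (f u) <= C.
      by have := H 0%N u ur; rewrite big_ord0 sub0r modcN expr0 mulr1.
    have H1 : modc (P - f u) <= C * q.
      apply: le_trans (H N u ur) _; rewrite ler_wpM2l// ler_wiXn2l ?invr_ge0 ?invf_le1 ?ler1n//.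
      by rewrite /N addnS -addSn leq_addl.
    have q1 : q <= 1 by rewrite exprn_ile1// invf_le1// ler1n.
    have H2 : modc P <= 2 * C.
      rewrite -(subrK (f u) P) (le_trans (modcD _ _))//.
      apply: le_trans (lerD H1 H0) _; rewrite [leRHS]mulr_natl mulr2n lerD2r.
      by rewrite ler_piMr.
    have H3 : modc P <= modc (f u) + C * q.
      by rewrite -(subrK (f u) P) (le_trans (modcD _ _))// addrC lerD2l.
    have M0 := modc_ge0 P; have F0 := modc_ge0 (f u).
    have Cq0 : 0 <= C * q by rewrite mulr_ge0.
    move: H2 H3 M0 F0 Cq0 C0 q0 => {}; move: (modc P) (modc (f u)) => x y.
    move=> x2 xy x0 y0 Cq0 C0 q0.
    have : 0 <= (2 * C - x) * (C * q) by rewrite mulr_ge0// subr_ge0.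
    (* If x > C q, the inequality x - C q <= y can be squared; otherwise x^2 is itself below the
       error term. *)
    case: (leP x (C * q)) => xc.
      by nra.
    by nra.
  apply/cvgrPdist_lt => e e0; have [N0 HN] := half_small (4 * C ^+ 2) e0.
  exists N0 => // k /= /HN lt_e; rewrite -/(S p).
  rewrite ger0_norm ?subr_ge0 ?ge_min ?lexx ?orbT//.
  rewrite ltrBlDr; case: (leP (A k p) (S p)) => _; last by rewrite ltrDr.
  by rewrite -ltrBlDl; apply: lt_le_trans (low k); rewrite ltrD2l ltrN2.
- move=> k; apply: (@le_trans _ _ (gI (A k))).
    apply: gI_le => //.
      split; first by apply: measurable_minr; [case: (nA k)|case: nS].
      by move=> p; rewrite le_min; case: (nA k) => _ ->; case: nS => _ ->.
    by move=> p; rewrite ge_min lexx.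
  rewrite (gI_avg (oP k))//; first exact: cmeas_pser_cpt1 fP.
  by move=> u; exact: cmeas_pser_cpt fP.
Qed.

(** By [W_ge] the weights outgrow every geometric sequence, so a bound on each single term
    suffices. *)
Lemma rapid_fock a (B : R) : (forall K, \sum_(n < K) modc (a n) ^+ 2 * W n <= B) -> rapid a.
Proof.
move=> HB r r0; have [c c0 cP] := W_ge alpha_gt0 r0.
have term n : (modc (a n) * r ^+ n) ^+ 2 <= B / c.
  rewrite ler_pdivlMr// (le_trans _ (HB n.+1))// big_ord_recr/=.
  rewrite (@le_trans _ _ (modc (a n) ^+ 2 * W n))//.
    by rewrite exprMn -mulrA ler_wpM2l ?sqr_ge0// mulrC.
  rewrite lerDr; apply: sumr_ge0 => i _.
  by rewrite mulr_ge0 ?sqr_ge0// ltW// W_gt0.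
exists (B / c + 1) => n; have := term n; set x := modc _ * _.
by have := sqr_ge0 (x - 1); nra.
Qed.

End Parseval.
(** * The Hausdorff operator as a coefficient multiplier *)

Section HausdorffPowerSeries.
Variables (R : realType) (mu : {measure set R -> \bar R}) (M : R).
Hypothesis mu01 : mu `]0, 1[ = 0%E.
Hypothesis momentM : forall n, (moment mu n <= M%:E)%E.
Implicit Types (a : nat -> R[i]) (f : R[i] -> R[i]) (n N : nat) (t : R).

Let Dpos : set R := `]0, +oo[.
Let D1 : set R := `[1, +oo[.

Let mDpos : measurable Dpos. Proof. exact: measurable_itv. Qed.
Let mD1 : measurable D1. Proof. exact: measurable_itv. Qed.

Lemma D1P t : D1 t -> 1 <= t.
Proof. by rewrite /D1 /= in_itv/= andbT. Qed.

Lemma D1_sub : D1 `<=` Dpos.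
Proof. by move=> t /D1P t1; rewrite /Dpos /= in_itv/= andbT (lt_le_trans _ t1). Qed.

(** Positive and negative parts are compared separately, so that no integrability has to be
    assumed. *)
Lemma Rintegral_Dpos (h : R -> R) : measurable_fun Dpos h ->
  \int[mu]_(t in Dpos) h t = \int[mu]_(t in D1) h t.
Proof.
move=> mh; have mhE : measurable_fun Dpos (EFin \o h) by apply/measurable_EFinP.
have DE : Dpos `\` `]0, 1[%classic = D1.
  apply/seteqP; split => t; rewrite /Dpos /D1 /= !in_itv/= !andbT.
    by move=> [t0 /negP]; rewrite t0/= -leNgt.
  by move=> t1; rewrite (lt_le_trans ltr01 t1); split=> //; apply/negP; rewrite -leNgt.
congr fine; rewrite integralE [RHS]integralE.
have N (k : R -> \bar R) : measurable_fun Dpos k -> (forall t, (0 <= k t)%E) ->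
    (\int[mu]_(t in Dpos) k t = \int[mu]_(t in D1) k t)%E.
  move=> mk k0; rewrite (@ge0_negligible_integral _ _ _ mu Dpos `]0, 1[%classic)//.
  by rewrite DE.
rewrite !N//.
- exact: measurable_funeneg.
- exact: measurable_funepos.
Qed.

Lemma measurable_inv_pos : measurable_fun Dpos (@GRing.inv R).
Proof.
apply: open_continuous_measurable_fun; first exact: interval_open.
move=> t; rewrite inE /Dpos/= in_itv/= andbT => t0.
by apply: inv_continuous; rewrite gt_eqF.
Qed.

Lemma measurable_expinv n : measurable_fun Dpos (fun t => (t ^+ n.+1)^-1).
Proof.
by under eq_fun do rewrite -exprVn; apply: measurable_funX; exact: measurable_inv_pos.
Qed.

Lemma moment_ge0 n : (0 <= moment mu n)%E.
Proof.
apply: integral_ge0 => t /D1P t1; rewrite lee_fin invr_ge0 exprn_ge0//.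
exact: le_trans t1.
Qed.

Definition mom n : R := fine (moment mu n).

Lemma momE n : moment mu n = (mom n)%:E.
Proof.
rewrite fineK// ge0_fin_numE; last exact: moment_ge0.
by rewrite (le_lt_trans (momentM n))// ltry.
Qed.

Lemma mom_ge0 n : 0 <= mom n.
Proof. by rewrite -lee_fin -momE moment_ge0. Qed.

Lemma mom_le n : mom n <= M.
Proof. by rewrite -lee_fin -momE. Qed.

Lemma normr_mom n : `|mom n| <= M.
Proof. by rewrite ger0_norm ?mom_ge0 ?mom_le. Qed.

Lemma mom_nonincreasing : {homo mom : m n / (m <= n)%N >-> n <= m}.
Proof.
apply: homo_leq => // [x y z yx zy|n]; first exact: le_trans zy yx.
rewrite -lee_fin -!momE; apply: ge0_le_integral => //.
- by move=> t /D1P t1; rewrite lee_fin invr_ge0 exprn_ge0// (le_trans _ t1).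
- by apply/measurable_EFinP; apply: measurable_funS D1_sub (measurable_expinv n.+1).
- by apply/measurable_EFinP; apply: measurable_funS D1_sub (measurable_expinv n).
move=> t /D1P t1; have t0 : 0 < t by exact: lt_le_trans t1.
by rewrite lee_fin lef_pV2 ?posrE ?exprn_gt0// ler_weXn2l.
Qed.

Lemma integrable_expinv n : mu.-integrable D1 (EFin \o (fun t => (t ^+ n.+1)^-1)).
Proof.
apply/integrableP; split.
  by apply/measurable_EFinP; apply: measurable_funS D1_sub (measurable_expinv n).
apply: le_lt_trans (ltry M); apply: le_trans (momentM n).
rewrite le_eqVlt; apply/orP; left; apply/eqP; apply: eq_integral => t.
rewrite inE => /D1P t1; rewrite /= ger0_norm// invr_ge0 exprn_ge0// (le_trans _ t1)//.
Qed.

Lemma Rintegral_expinv n : \int[mu]_(t in D1) (t ^+ n.+1)^-1 = mom n.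
Proof. by []. Qed.

Lemma integrable_scale (c : R) (h : R -> R) : mu.-integrable D1 (EFin \o h) ->
  mu.-integrable D1 (EFin \o (fun t => c * h t)).
Proof. by move=> ih; have := integrableZl mD1 c ih; exact. Qed.

(** The dominating function C / t is integrable because the integral of 1 / t is the moment of index
    0. *)
Lemma integrable_le (h : R -> R) (C : R) : measurable_fun Dpos h ->
  (forall t, 1 <= t -> `|h t| <= C / t) -> mu.-integrable D1 (EFin \o h).
Proof.
move=> mh hC; apply: (le_integrable mD1 _ _ (integrable_scale C (integrable_expinv 0))).
- by apply/measurable_EFinP; apply: measurable_funS D1_sub mh.
- move=> t /D1P t1; rewrite /= lee_fin (le_trans (hC _ t1))// expr1.
  by rewrite ler_norm.
Qed.

Lemma Rintegral_bound (h : R -> R) (C : R) : measurable_fun Dpos h ->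
  (forall t, 1 <= t -> `|h t| <= C / t) -> `|\int[mu]_(t in D1) h t| <= C * mom 0.
Proof.
move=> mh hC; have ih := integrable_le mh hC.
rewrite (le_trans (le_normr_Rintegral _ ih))// -Rintegral_expinv -RintegralZl//;
  last exact: integrable_expinv.
apply: le_Rintegral => //.
- exact: (integrable_norm ih).
- exact: integrable_scale (integrable_expinv 0).
- by move=> t /D1P t1; rewrite expr1 hC.
Qed.

Definition dil f (z : R[i]) t : R[i] := (t^-1)%:C * f (z / t%:C).

Lemma cmeas_inv : cmeas Dpos (fun t => (t^-1)%:C).
Proof. by split; [exact: measurable_inv_pos|exact: measurable_cst]. Qed.

Lemma cmeas_dil a f z : pser a f -> cmeas Dpos (dil f z).
Proof.
move=> fP; apply: cmeasM; first exact: cmeas_inv.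
apply: (cmeas_pser fP); apply: cmeasM; first exact: cmeas_cst.
have := cmeas_inv; congr cmeas; apply/funext => t.
by rewrite -[RHS]fmorphV.
Qed.

(** The integrand [dil] with [f] replaced by a Taylor polynomial, sorted by powers of 1 / t so that
    integration produces the moments. *)
Definition qpoly a (z : R[i]) N t : R[i] := \sum_(n < N) a n * z ^+ n * ((t ^+ n.+1)^-1)%:C.

Lemma qpolyE a z N t : qpoly a z N t = (t^-1)%:C * \sum_(n < N) a n * (z / t%:C) ^+ n.
Proof.
rewrite mulr_sumr; apply: eq_bigr => n _.
have E (x : R) : (x^-1)%:C = (x%:C)^-1 :> R[i] by rewrite fmorphV.
by rewrite !E rmorphXn/= exprMn exprVn exprS invfM; ring.
Qed.

Lemma cmeas_qpoly a z N : cmeas Dpos (qpoly a z N).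
Proof.
elim: N => [|N ih].
  by rewrite /qpoly; under eq_fun do rewrite big_ord0; exact: cmeas_cst.
rewrite /qpoly; under eq_fun do rewrite big_ord_recr/=.
apply: cmeasD => //; apply: cmeasM; first exact: cmeas_cst.
by split; [exact: measurable_expinv|exact: measurable_cst].
Qed.

(** [P] stands for the real or the imaginary part. *)
Lemma Rintegral_part (P : R[i] -> R) a f z (C : R) N :
  (forall g, cmeas Dpos g -> measurable_fun Dpos (P \o g)) ->
  (forall u v, P (u + v) = P u + P v) -> (forall u (x : R), P (u * x%:C) = P u * x) ->
  (forall u, `|P u| <= modc u) -> pser a f -> 0 <= C ->
  (forall N w, modc w <= modc z -> modc (\sum_(n < N) a n * w ^+ n - f w) <= C * (2^-1) ^+ N) ->
  `|\sum_(n < N) P (a n * z ^+ n) * mom n - \int[mu]_(t in Dpos) P (dil f z t)| <=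
  C * (2^-1) ^+ N * mom 0.
Proof.
move=> mP PD PZ PN fP C0 H.
have mdil := mP _ (cmeas_dil z fP).
have P0 : P 0 = 0 by have := PD 0 0; rewrite addr0 -{1}[P 0]addr0 => /addrI <-.
have PB u v : P (u - v) = P u - P v by apply/eqP; rewrite eq_sym subr_eq -PD subrK.
(* Here the concentration of [mu] on [1, oo[ enters: all dilated points stay in the disc of radius
   |z|, where one constant [C] controls the Taylor error. *)
have small t : 1 <= t -> modc (z / t%:C) <= modc z.
  move=> t1; rewrite modcM modcV modcR ger0_norm ?(le_trans _ t1)//.
  by rewrite ler_piMr ?modc_ge0// invf_le1// (lt_le_trans _ t1).
have dilC t : 1 <= t -> modc (dil f z t) <= C / t.
  move=> t1; rewrite modcM modcR ger0_norm ?invr_ge0 ?(le_trans _ t1)// mulrC.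
  rewrite ler_wpM2r ?invr_ge0 ?(le_trans _ t1)//.
  by have := H 0%N _ (small t t1); rewrite big_ord0 sub0r modcN expr0 mulr1.
have idil : mu.-integrable D1 (EFin \o (P \o dil f z)).
  by apply: (@integrable_le _ C) => // t t1; rewrite (le_trans (PN _))// dilC.
have qsum K : mu.-integrable D1 (EFin \o (fun t => P (qpoly a z K t))) /\
    \int[mu]_(t in D1) P (qpoly a z K t) = \sum_(n < K) P (a n * z ^+ n) * mom n.
  elim: K => [|K [iK EK]].
    rewrite big_ord0.
    have E : (fun t => P (qpoly a z 0 t)) = (fun t => 0 * (t ^+ 1)^-1).
      by apply/funext => t; rewrite /qpoly big_ord0 P0 mul0r.
    rewrite E; split.
      apply: (@integrable_le _ 0); last by move=> t _; rewrite !mul0r normr0.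
      by under eq_fun do rewrite mul0r; exact: measurable_cst.
    by rewrite RintegralZl ?mul0r//; exact: integrable_expinv.
  have E : (fun t => P (qpoly a z K.+1 t)) =
      (fun t => P (qpoly a z K t) + P (a K * z ^+ K) * (t ^+ K.+1)^-1).
    by apply/funext => t; rewrite /qpoly big_ord_recr/= PD PZ.
  have iT : mu.-integrable D1 (EFin \o (fun t => P (a K * z ^+ K) * (t ^+ K.+1)^-1)).
    exact: integrable_scale (integrable_expinv K).
  rewrite E big_ord_recr/=; split.
    by have := integrableD mD1 iK iT; exact.
  rewrite RintegralD// EK; congr (_ + _).
  by rewrite RintegralZl//; exact: integrable_expinv.
rewrite Rintegral_Dpos// -(qsum N).2 -RintegralB//; [|by case: (qsum N)].
apply: Rintegral_bound.
  by apply: measurable_funB => //; apply: mP; exact: cmeas_qpoly.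
move=> t t1; rewrite -PB (le_trans (PN _))// qpolyE /dil -mulrBr modcM modcR.
have ti : 0 <= t^-1 by rewrite invr_ge0 (le_trans _ t1).
by rewrite (ger0_norm ti) mulrC ler_wpM2r// H// small.
Qed.

Lemma hausdorff_pser a f : pser a f ->
  pser (fun n => (mom n)%:C * a n) (hausdorff mu f).
Proof.
move=> fP; split; first by apply: rapid_scale fP.1 => n; exact: normr_mom.
move=> r r0; have [C C0 H] := fP.2 r r0.
(* One copy of C * mom 0 for the real part and one for the imaginary part; [mom 0] is the integral
   of the factor 1 / t. *)
exists (2 * (C * mom 0)); first by rewrite !mulr_ge0// mom_ge0.
move=> N z zr.
have Hz K w : modc w <= modc z -> modc (\sum_(n < K) a n * w ^+ n - f w) <= C * (2^-1) ^+ K.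
  by move=> wz; apply: H; exact: le_trans zr.
have HR := @Rintegral_part (@complex.Re R) a f z C N (fun g mg => mg.1) (@cReD R)
  (fun u x => _) (@normr_Re R) fP C0 Hz.
have HI := @Rintegral_part (@complex.Im R) a f z C N (fun g mg => mg.2) (@cImD R)
  (fun u x => _) (@normr_Im R) fP C0 Hz.
rewrite (le_trans (modc_le_ReIm _))// cReB cImB.
have -> : complex.Re (\sum_(n < N) (mom n)%:C * a n * z ^+ n) =
    \sum_(n < N) complex.Re (a n * z ^+ n) * mom n.
  rewrite (big_morph _ (@cReD R) (erefl : complex.Re (0 : R[i]) = 0)); apply: eq_bigr => n _.
  by rewrite -mulrA mulrC; case: (a n * z ^+ n) => x y; rewrite cReM/= mulr0 subr0.
have -> : complex.Im (\sum_(n < N) (mom n)%:C * a n * z ^+ n) =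
    \sum_(n < N) complex.Im (a n * z ^+ n) * mom n.
  rewrite (big_morph _ (@cImD R) (erefl : complex.Im (0 : R[i]) = 0)); apply: eq_bigr => n _.
  by rewrite -mulrA mulrC; case: (a n * z ^+ n) => x y; rewrite cImM/= mulr0 add0r.
have -> : 2 * (C * mom 0) * (2^-1) ^+ N = C * (2^-1) ^+ N * mom 0 + C * (2^-1) ^+ N * mom 0 by ring.
apply: lerD; [apply: HR|apply: HI].
- by move=> [x y] c; rewrite cReM/= mulr0 subr0.
- by move=> [x y] c; rewrite cImM/= mulr0 add0r.
Qed.

End HausdorffPowerSeries.
(** * Compactness *)

Section CompactnessCriterion.
Variable R : realType.
Implicit Types (a b : nat -> R[i]) (f g : R[i] -> R[i]).

Lemma ge0_ecvg0P (u : nat -> \bar R) : (forall k, (0 <= u k)%E) ->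
  (u @ \oo --> 0%E) <->
  (forall e : R, 0 < e -> exists N0, forall k, (N0 <= k)%N -> (u k <= e%:E)%E).
Proof.
move=> u0; split=> [/fine_cvgP[[N1 _ H1] /cvgrPdist_le H2] e e0|H].
  have [N2 _ {}H2] := H2 e e0; exists (maxn N1 N2) => k; rewrite geq_max => /andP[k1 k2].
  have := H2 k k2; rewrite /= sub0r normrN -(fineK (H1 k k1)) lee_fin.
  by apply: le_trans; exact: ler_norm.
apply/fine_cvgP; split.
  have [N0 H0] := H 1 ltr01; exists N0 => // k /= /H0 uk.
  by rewrite ge0_fin_numE// (le_lt_trans uk)// ltry.
apply/cvgrPdist_le => e e0; have [N0 H0] := H e e0; exists N0 => // k /= /H0 uk.
rewrite sub0r normrN ger0_norm ?fine_ge0// -lee_fin fineK//.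
by rewrite ge0_fin_numE// (le_lt_trans uk)// ltry.
Qed.

Lemma bounded_terms_cvg0 (v : nat -> R) (B : R) : (forall n, 0 <= v n) ->
  (forall K, \sum_(n < K) v n <= B) -> forall e : R, 0 < e ->
  exists N0, forall n, (N0 <= n)%N -> v n <= e.
Proof.
move=> v0 vB e e0.
have : v @ \oo --> (0 : R).
  apply: cvg_series_cvg_0; apply: nondecreasing_is_cvgn.
    exact: nondecreasing_series.
  by exists B => _ [K _ <-]; rewrite /series/= big_mkord.
move=> /cvgrPdist_le/(_ e e0)[N0 _ H]; exists N0 => n /H /=.
by rewrite sub0r normrN; apply: le_trans; exact: ler_norm.
Qed.

(** Compactness of [-C, C] gives a cluster point of the image filter, and for an ultrafilter a
    cluster point is a limit: otherwise the complement of some neighbourhood would belong to the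
    filter. *)
Lemma ultra_bounded_cvg (U : set_system nat) (v : nat -> R) (C : R) : UltraFilter U ->
  (forall k, `|v k| <= C) ->
  exists x, forall e : R, 0 < e -> U [set k | `|v k - x| < e].
Proof.
move=> UU vC; have PU : ProperFilter U by exact: ultra_proper.
have SU : fmap v U `[- C, C]%classic.
  suff : U (v @^-1` `[- C, C]%classic) by [].
  by apply: filterS (@filterT _ U _) => k _; rewrite /= in_itv/= -ler_norml; exact: vC.
have [x [_ xcl]] := @segment_compact R (- C) C (fmap v U) _ SU.
exists x => e e0; set S := [set k | _].
have [//|US] := in_ultra_setVsetC S UU.
have [||y [[k Sk <-] xy]] // := xcl (v @` (~` S)) (ball x e).
- suff : U (v @^-1` (v @` (~` S))) by [].
  by apply: filterS US => k Sk; exists k.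
- exact: nbhsx_ballx.
- by case: Sk; rewrite /S/= distrC.
Qed.

Lemma cplx_ultra_cvg (U : set_system nat) (v : nat -> R[i]) (C : R) : UltraFilter U ->
  (forall k, modc (v k) <= C) ->
  exists x, forall e : R, 0 < e -> U [set k | modc (v k - x) < e].
Proof.
move=> UU vC.
have [x Hx] := ultra_bounded_cvg UU (fun k => le_trans (normr_Re (v k)) (vC k)).
have [y Hy] := ultra_bounded_cvg UU (fun k => le_trans (normr_Im (v k)) (vC k)).
exists (x +i* y) => e e0; have e20 : 0 < e / 2 by rewrite divr_gt0.
apply: filterS (filterI (Hx _ e20) (Hy _ e20)) => k [/= H1 H2].
by rewrite (le_lt_trans (modc_le_ReIm _))// cReB cImB/= [e]splitr ltrD.
Qed.

Lemma subseq_coef_cvg (A : nat -> nat -> R[i]) (C : nat -> R) :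
  (forall k n, modc (A k n) <= C n) ->
  exists (phi : nat -> nat) (b : nat -> R[i]), (forall j, (phi j < phi j.+1)%N) /\
    forall j n, (n < j)%N -> modc (A (phi j) n - b n) <= j.+1%:R^-1.
Proof.
move=> AC.
have [U [UU oU]] := @ultraFilterLemma nat \oo _.
have PU : ProperFilter U by exact: ultra_proper.
have /choice[b bP] : forall n, exists x, forall e : R, 0 < e -> U [set k | modc (A k n - x) < e].
  by move=> n; exact: (cplx_ultra_cvg UU (fun k => AC k n)).
(* Closeness in the first [j] coefficients is a finite intersection of members of [U], and the
   indices beyond [m] also form a member; their intersection is not empty. *)
have step m j : exists k, (m < k)%N /\ forall n, (n < j)%N -> modc (A k n - b n) <= j.+1%:R^-1.
  have Uj J : U [set k | forall n, (n < J)%N -> modc (A k n - b n) <= j.+1%:R^-1].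
    elim: J => [|J ih]; first by apply: filterS (@filterT _ U _).
    have j0 : 0 < j.+1%:R^-1 :> R by rewrite invr_gt0.
    apply: filterS (filterI ih (bP J _ j0)) => k [/= H1 H2] n.
    by rewrite ltnS leq_eqVlt => /predU1P[->|/H1//]; exact: ltW.
  have Um : U [set k | (m < k)%N] by apply: oU; exists m.+1.
  by have [k [H1 H2]] := filter_ex (filterI Um (Uj j)); exists k.
have /choice[s sP] : forall mj : nat * nat, exists k, (mj.1 < k)%N /\
    forall n, (n < mj.2)%N -> modc (A k n - b n) <= mj.2.+1%:R^-1.
  by move=> [m j]; exact: step.
(* The starting value is arbitrary, since the closeness condition is vacuous at j = 0. *)
pose phi := fix phi j := if j is j'.+1 then s (phi j', j'.+1) else 0%N.
exists phi, b; split=> [j|[//|j] n nj]; first by have [] := sP (phi j, j.+1).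
by have [_] := sP (phi j, j.+1); apply.
Qed.

Section Criterion.
Variables (alpha : R) (mu : {measure set R -> \bar R}) (M : R).
Hypothesis alpha_gt0 : 0 < alpha.
Hypothesis mu01 : mu `]0, 1[ = 0%E.
Hypothesis momentM : forall n, (moment mu n <= M%:E)%E.
Local Notation W := (W alpha).
Local Notation mom := (mom mu).
Local Notation hpser := (hausdorff_pser mu01 momentM).
Local Notation W_gt0 := (W_gt0 alpha_gt0).

Let W_ge0 n : 0 <= W n. Proof. by rewrite ltW// W_gt0. Qed.

Let term_ge0 (x : R[i]) n : 0 <= modc x ^+ 2 * W n.
Proof. by rewrite mulr_ge0 ?sqr_ge0. Qed.

Let factor2 (x y w : R) : 2 * (x * w) + 2 * (y * w) = (2 * x + 2 * y) * w.
Proof. by ring. Qed.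

Lemma fock_ge0 a f : pser a f -> (0 <= fock_norm2 alpha f)%E.
Proof.
by move=> fP; apply: gI_ge0 => //; apply: nnm_sqr_modc; exact: cmeas_pser_cpt1 fP.
Qed.

Lemma in_fockP f : in_fock alpha f <-> exists a, pser a f /\
  exists B : R, forall K, \sum_(n < K) modc (a n) ^+ 2 * W n <= B.
Proof.
split=> [[/entire_pser[a fP] ffin]|[a [fP [B HB]]]].
  exists a; split=> //; exists (fine (fock_norm2 alpha f)) => K.
  apply: (coef_le_fock alpha_gt0 K fP); rewrite fineK//.
  by rewrite ge0_fin_numE//; exact: fock_ge0 fP.
split; first exact: pser_entire fP.
by apply: le_lt_trans (fock_le_coef alpha_gt0 fP HB) _; rewrite ltry.
Qed.

Lemma pser_monomial (c : R[i]) k :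
  pser (fun n => if n == k then c else 0) (fun z => c * z ^+ k).
Proof.
split=> r r0.
  exists (modc c * r ^+ k) => n; case: eqVneq => [->//|_].
  by rewrite modc0 mul0r mulr_ge0 ?modc_ge0 ?exprn_ge0.
(* Partial sums of length N <= k are 0, so the whole monomial is the error; 2^k compensates the
   factor 2^-N there. *)
exists (modc c * r ^+ k * 2 ^+ k); first by rewrite !mulr_ge0 ?modc_ge0 ?exprn_ge0.
move=> N z zr; have [kN|Nk] := ltnP k N.
  rewrite (bigD1 (Ordinal kN))//= eqxx big1 ?addr0.
    by rewrite subrr modc0 !mulr_ge0 ?modc_ge0 ?exprn_ge0 ?invr_ge0.
  by move=> i /negPf ik; rewrite -val_eqE/= in ik; rewrite ik mul0r.
rewrite big1; last by move=> i _; rewrite ltn_eqF ?mul0r// (leq_trans (ltn_ord i)).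
have h : 1 <= 2 ^+ k * (2^-1) ^+ N :> R.
  by rewrite exprVn -{1}(subnK Nk) exprD mulfK ?expf_neq0// exprn_ege1// ler1n.
rewrite sub0r modcN modcM modcX -[leRHS]mulrA.
apply: (@le_trans _ _ (modc c * r ^+ k)).
  by rewrite ler_wpM2l ?modc_ge0// lerXn2r ?nnegrE ?modc_ge0.
by rewrite ler_peMr// mulr_ge0 ?modc_ge0 ?exprn_ge0.
Qed.

Lemma coef_monomial (c : R[i]) k K :
  \sum_(n < K) modc (if n == k :> nat then c else 0) ^+ 2 * W n <= modc c ^+ 2 * W k.
Proof.
have [kK|Kk] := ltnP k K.
  rewrite (bigD1 (Ordinal kK))//= eqxx big1 ?addr0//.
  by move=> i /negPf ik; rewrite -val_eqE/= in ik; rewrite ik modc0 expr0n/= mul0r.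
rewrite big1; first by rewrite mulr_ge0 ?sqr_ge0.
by move=> i _; rewrite ltn_eqF ?modc0 ?expr0n ?mul0r// (leq_trans (ltn_ord i)).
Qed.

Lemma compact_moment0 : compact_on_fock alpha (hausdorff mu) ->
  forall e : R, 0 < e -> exists N0, forall n, (N0 <= n)%N -> mom n <= e.
Proof.
move=> [_ cpt] e e0; pose c k : R[i] := ((Num.sqrt (W k))^-1)%:C.
have c2 k : modc (c k) ^+ 2 * W k = 1.
  rewrite modcR ger0_norm ?invr_ge0// exprVn sqr_sqrtr// mulVf// gt_eqF//.
  exact: W_gt0.
pose u k (z : R[i]) := c k * z ^+ k.
have uP k := pser_monomial (c k) k.
have ucoef k K : \sum_(n < K) modc (if n == k :> nat then c k else 0) ^+ 2 * W n <= 1.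
  by rewrite -(c2 k) coef_monomial.
have uin k : in_fock alpha (u k).
  by apply/in_fockP; exists (fun n => if n == k then c k else 0); split=> //; exists 1.
have [|phi [phiS [g [gin cv]]]] := cpt u uin.
  by exists 1 => k; apply: (fock_le_coef alpha_gt0 (uP k)).
have /in_fockP[b [gP [B HB]]] := gin.
have DP k := pserB (hpser (uP (phi k))) gP.
have phi_ge k : (k <= phi k)%N by elim: k => // k ih; exact: leq_ltn_trans (phiS k).
(* Both the distance to [g] and the coefficient of [g] are made at most e^2 / 4, because |x|^2 <= 2
   |x - b|^2 + 2 |b|^2 at the end. *)
have d0 : 0 < e ^+ 2 / 4 by rewrite divr_gt0// exprn_gt0.
have /ge0_ecvg0P H := cv.
have [|N1 H1] := H _ _ d0; first by move=> k; exact: fock_ge0 (DP k).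
have [N2 H2] := bounded_terms_cvg0 (fun n => term_ge0 (b n) n) HB d0.
(* Only the coefficient of index m = phi k is inspected, the one where the image of the monomial
   lives; since phi k >= k, it also lies in the small tail of [g]. *)
pose k := maxn N1 N2; pose m := phi k; exists m => n mn.
apply: le_trans (mom_nonincreasing momentM mn) _.
have {}H1 := H1 k (leq_maxl _ _).
have {}H2 := H2 m (leq_trans (leq_maxr _ _) (phi_ge k)).
have H3 := coef_le_fock alpha_gt0 m.+1 (DP k) H1.
have {}H3 : modc ((mom m)%:C * c m - b m) ^+ 2 * W m <= e ^+ 2 / 4.
  apply: le_trans H3; rewrite big_ord_recr/= eqxx lerDr; apply: sumr_ge0 => i _.
  by rewrite mulr_ge0 ?sqr_ge0.
have m0 := mom_ge0 momentM m.
rewrite -ler_sqr ?nnegrE ?(ltW e0)//.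
have -> : mom m ^+ 2 = modc ((mom m)%:C * c m) ^+ 2 * W m.
  by rewrite modcM modcR (ger0_norm m0) exprMn -mulrA c2 mulr1.
set x := (mom m)%:C * c m in H3 *; have Wm := W_gt0 m.
have xb : modc x <= modc (x - b m) + modc (b m) by rewrite -{1}(subrK (b m) x) modcD.
have x0 := modc_ge0 x; have y0 := modc_ge0 (x - b m); have z0 := modc_ge0 (b m).
have : modc x ^+ 2 <= 2 * (modc (x - b m) ^+ 2 + modc (b m) ^+ 2).
  apply: (@le_trans _ _ ((modc (x - b m) + modc (b m)) ^+ 2)).
    by rewrite lerXn2r ?nnegrE ?addr_ge0.
  by have := sqr_ge0 (modc (x - b m) - modc (b m)); rewrite sqrrB sqrrD; lra.
move=> h; apply: le_trans (ler_wpM2r (ltW Wm) h) _.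
by rewrite -mulrA mulrDl; clear -H2 H3; lra.
Qed.

Lemma hausdorff_in_fock f : in_fock alpha f -> in_fock alpha (hausdorff mu f).
Proof.
move=> /in_fockP[a [fP [B HB]]]; apply/in_fockP.
exists (fun n => (mom n)%:C * a n); split; first exact: hpser.
have M0 : 0 <= M by apply: le_trans (mom_ge0 momentM 0) (mom_le momentM 0).
exists (M ^+ 2 * B) => K; apply: le_trans (ler_wpM2l (sqr_ge0 M) (HB K)).
rewrite mulr_sumr; apply: ler_sum => n _; rewrite modcM modcR exprMn -mulrA.
rewrite ler_wpM2r ?term_ge0// lerXn2r ?nnegrE//.
exact: normr_mom.
Qed.

Lemma moment0_compact : (forall e : R, 0 < e -> exists N0, forall n, (N0 <= n)%N -> mom n <= e) ->
  compact_on_fock alpha (hausdorff mu).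
Proof.
move=> mom0; split; first exact: hausdorff_in_fock.
move=> u uin [B uB].
have /choice[A AP] : forall k, exists a, pser a (u k) /\
    forall K, \sum_(n < K) modc (a n) ^+ 2 * W n <= B.
  move=> k; have [/entire_pser[a aP] _] := uin k.
  by exists a; split=> // K; exact: (coef_le_fock alpha_gt0 K aP).
have B0 : 0 <= B by have := (AP 0%N).2 0%N; rewrite big_ord0.
(* The inequality x <= x^2 + 1 avoids a square root. *)
have AC k n : modc (A k n) <= B / W n + 1.
  have : modc (A k n) ^+ 2 <= B / W n.
    rewrite ler_pdivlMr ?W_gt0//; apply: le_trans ((AP k).2 n.+1).
    by rewrite big_ord_recr/= lerDr; apply: sumr_ge0 => i _; exact: term_ge0.
  by have := sqr_ge0 (modc (A k n) - 1); rewrite sqrrB; have := modc_ge0 (A k n); nra.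
have [phi [b [phiS close]]] := subseq_coef_cvg AC.
have small (C d : R) : 0 <= C -> 0 < d ->
    exists J, forall j, (J <= j)%N -> (j.+1%:R^-1) ^+ 2 * C <= d.
  move=> C0 d0; pose J := Num.bound (C / d); exists J => j Jj.
  have j0 : 0 < j.+1%:R :> R by [].
  have CJ : C / d < j.+1%:R.
    apply: (@lt_le_trans _ _ J%:R); first by apply: archi_boundP; rewrite divr_ge0// ltW.
    by rewrite ler_nat leqW.
  have j1 : j.+1%:R^-1 <= 1 :> R by rewrite invf_le1// ler1n.
  rewrite expr2 -mulrA; apply: (@le_trans _ _ (j.+1%:R^-1 * C)).
    by rewrite ler_piMl// mulr_ge0// invr_ge0.
  by rewrite mulrC ler_pdivrMr// mulrC -ler_pdivrMr// ltW.
have sumW_ge0 K : 0 <= \sum_(n < K) W n by apply: sumr_ge0.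
have near j N : (N <= j)%N -> \sum_(n < N) modc (A (phi j) n - b n) ^+ 2 * W n <=
    (j.+1%:R^-1) ^+ 2 * \sum_(n < N) W n.
  move=> Nj; rewrite mulr_sumr; apply: ler_sum => n _; rewrite ler_wpM2r//.
  rewrite lerXn2r ?nnegrE ?modc_ge0 ?invr_ge0//; apply: close.
  exact: leq_trans (ltn_ord n) Nj.
have sq2 (x y : R[i]) : modc (x - y) ^+ 2 <= 2 * modc x ^+ 2 + 2 * modc y ^+ 2.
  apply: (@le_trans _ _ ((modc x + modc y) ^+ 2)).
    by rewrite lerXn2r ?nnegrE ?addr_ge0 ?modc_ge0// modcB.
  by have := sqr_ge0 (modc x - modc y); rewrite sqrrB sqrrD; lra.
(* For each [K] a late index [j] makes the first [K] terms of the squared distance sum to at most 1;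
   the bound does not depend on [K]. *)
have bB K : \sum_(n < K) modc (b n) ^+ 2 * W n <= 2 * B + 2.
  have [J HJ] := small _ 1 (sumW_ge0 K) ltr01; pose j := maxn J K.
  have H1 := near j K (leq_maxr _ _); have H2 := HJ j (leq_maxl _ _).
  have H3 := (AP (phi j)).2 K.
  apply: (@le_trans _ _ (2 * \sum_(n < K) modc (A (phi j) n) ^+ 2 * W n +
      2 * \sum_(n < K) modc (A (phi j) n - b n) ^+ 2 * W n)).
    rewrite !mulr_sumr -big_split/=; apply: ler_sum => n _.
    rewrite factor2 ler_wpM2r//.
    by have := sq2 (A (phi j) n) (A (phi j) n - b n); rewrite opprB [_ + (b n - _)]addrC subrK.
  by rewrite lerD// ?ler_wpM2l// -[leRHS]mulr1 ler_wpM2l// (le_trans H1).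
have brapid := rapid_fock alpha_gt0 bB.
have M0 : 0 <= M by apply: le_trans (mom_ge0 momentM 0) (mom_le momentM 0).
have [g gP] := pser_exists (rapid_scale (normr_mom momentM) brapid).
exists phi; split=> //; exists g; split.
  apply/in_fockP; exists (fun n => (mom n)%:C * b n); split=> //.
  exists (M ^+ 2 * (2 * B + 2)) => K; apply: le_trans (ler_wpM2l (sqr_ge0 M) (bB K)).
  rewrite mulr_sumr; apply: ler_sum => n _; rewrite modcM modcR exprMn -mulrA.
  rewrite ler_wpM2r ?term_ge0// lerXn2r ?nnegrE//.
  exact: normr_mom.
have DP j := pserB (hpser (AP (phi j)).1) gP.
apply/ge0_ecvg0P => [j|e e0]; first exact: fock_ge0 (DP j).
pose S := 2 * B + 2 * (2 * B + 2) + 1; have S0 : 0 < S by rewrite /S; lra.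
have AbS j K : \sum_(n < K) modc (A j n - b n) ^+ 2 * W n <= S.
  apply: (@le_trans _ _ (2 * \sum_(n < K) modc (A j n) ^+ 2 * W n +
      2 * \sum_(n < K) modc (b n) ^+ 2 * W n)).
    rewrite !mulr_sumr -big_split/=; apply: ler_sum => n _.
    by rewrite factor2 ler_wpM2r.
  have H1 := (AP j).2 K; have H2 := bB K.
  by rewrite /S; clear -H1 H2; lra.
(* The minimum with 1 gives d^2 <= d, so squared tail moments are at most [d] and the tail costs at
   most d * S <= e / 2. *)
pose d := Num.min 1 (e / 2 / S).
have d0 : 0 < d by rewrite lt_min ltr01 !divr_gt0.
have dS : d * S <= e / 2 by rewrite -ler_pdivlMr// ge_min lexx orbT.
have [N HN] := mom0 d d0.
have momd n : (N <= n)%N -> `|mom n| ^+ 2 <= d.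
  move=> /HN nd; rewrite ger0_norm ?(mom_ge0 momentM)// expr2.
  apply: (@le_trans _ _ (d * 1)); last by rewrite mulr1.
  rewrite ler_pM ?(mom_ge0 momentM)// (le_trans nd)//.
  by rewrite ge_min lexx.
have [|J HJ] := small (M ^+ 2 * \sum_(n < N) W n) (e / 2) _ (divr_gt0 e0 (ltr0Sn _ 1)).
  by rewrite mulr_ge0 ?sqr_ge0.
exists (maxn J N) => j; rewrite geq_max => /andP[Jj Nj].
apply: (fock_le_coef alpha_gt0 (DP j)) => K.
pose t n := modc ((mom n)%:C * A (phi j) n - (mom n)%:C * b n) ^+ 2 * W n.
have tE n : t n = `|mom n| ^+ 2 * (modc (A (phi j) n - b n) ^+ 2 * W n).
  by rewrite /t -mulrBr modcM modcR exprMn -[LHS]mulrA.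
have t0 n : 0 <= t n by rewrite mulr_ge0 ?sqr_ge0.
(* Lengthening the sum allows a split at [N] whatever [K] is: coefficient convergence handles the
   head, small moments handle the tail. *)
apply: (@le_trans _ _ (\sum_(n < N + K) t n)).
  by rewrite addnC big_split_ord/= lerDl; apply: sumr_ge0 => i _; exact: t0.
rewrite big_split_ord/= [e]splitr lerD//.
  apply: le_trans (HJ j Jj); rewrite mulrCA.
  apply: le_trans (ler_wpM2l (sqr_ge0 M) (near j N Nj)).
  rewrite mulr_sumr; apply: ler_sum => n _; rewrite tE ler_wpM2r ?term_ge0//.
  by rewrite lerXn2r ?nnegrE// (normr_mom momentM).
apply: le_trans dS; apply: le_trans (ler_wpM2l (ltW d0) (AbS (phi j) (N + K)%N)).
rewrite big_split_ord/= mulrDr ler_wpDl//.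
  by rewrite mulr_ge0 ?(ltW d0)//; apply: sumr_ge0 => i _; exact: term_ge0.
rewrite mulr_sumr; apply: ler_sum => n _; rewrite tE ler_wpM2r ?term_ge0//.
by rewrite momd// leq_addr.
Qed.

End Criterion.
End CompactnessCriterion.

Theorem theorem2 (R : realType) (alpha : R) (mu : {measure set R -> \bar R}) :
  0 < alpha ->
  mu `]-oo, 0] = 0%E ->
  mu `]0, 1[ = 0%E ->
  (exists M : R, forall n : nat,
     (moment mu n <= M%:E)%E) ->
  (compact_on_fock alpha (hausdorff mu) <->
   moment mu @ \oo --> 0%E).
Proof.
move=> alpha_gt0 _ mu01 [M momentM].
have momE0 : (forall e : R, 0 < e -> exists N0, forall n, (N0 <= n)%N -> mom mu n <= e) <->
    moment mu @ \oo --> 0%E.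
  rewrite (ge0_ecvg0P (moment_ge0 mu)); split=> H e /H[N0 HN]; exists N0 => n /HN;
    by rewrite (momE momentM) lee_fin.
split=> [H|/momE0 H]; last exact: (moment0_compact alpha_gt0 mu01 momentM).
by apply/momE0; exact: (compact_moment0 alpha_gt0 mu01 momentM).
Qed.
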